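(* Let $n\ge 2$, $m$ and $\delta\le m$ be positive integers with $\delta\ge \max\{n,\frac{m+10}{4}\}$. Let $G\in\mathcal{G}(n,m,\delta)$ with bipartition $(X,Y)$, and suppose that for every $A\subseteq X$ with $|A|\ge 3$ both of the following hold: (i) $|\widehat{N}(A)|\ge |A|$, and (ii) the induced subgraph $G[A\cup\widehat{N}(A)]$ is $2$-connected. Then $G$ is super-cyclic.
   Context: All graphs are finite and simple. For positive integers $n,m,\delta$ with $n\ge 2$ and $\delta\le m$, $\mathcal{G}(n,m,\delta)$ is the set of all bipartite graphs with a bipartition $(X,Y)$ such that $|X|=n$, $|Y|=m$ and $d(x)\ge\delta$ for every $x\in X$. $N(v)$ denotes the set of neighbors of $v$ in $G$. For $A\subseteq X$, the super-neighborhood of $A$ is $\widehat{N}(A)=\{y\in Y: |N(y)\cap A|\ge 2\}$. A bipartite graph $G$ with ordered bipartition $(X,Y)$ is super-cyclic if for every $X'\subseteq X$ with $|X'|\ge 3$, $G$ has a cycle $C$ with $V(C)\cap X=X'$. *)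

(* Defs.v *)
From mathcomp Require Import all_boot.

Set Implicit Arguments.
Unset Strict Implicit.
Unset Printing Implicit Defensive.

Record sgraph := SGraph {
  vertex :> finType;
  edge : rel vertex;
  edge_sym : symmetric edge;
  edge_irr : irreflexive edge }.

Section Graph.
Variable G : sgraph.
Implicit Types (S A X Y : {set G}) (v : G) (c : seq G).

Definition nbr v : {set G} := [set w | edge v w].

Definition independent S := {in S &, forall u v, ~~ edge u v}.

Definition bipartition X Y :=
  [/\ X :|: Y = [set: G], [disjoint X & Y], independent X & independent Y].

(* Adjacency in the induced subgraph G[S]; vertices outside S are isolated. *)
Definition induced_edge S : rel G :=
  [rel u v | [&& u \in S, v \in S & edge u v]].

(* G[S] is connected. *)
Definition connected_on S := {in S &, forall u v, connect (induced_edge S) u v}.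

(* G[S] is k-connected: it has more than k vertices and stays connected after
   the deletion of any set of fewer than k vertices. *)
Definition kconnected_on (k : nat) S :=
  k < #|S| /\
  forall D : {set G}, D \subset S -> #|D| < k -> connected_on (S :\: D).

(* The vertices of a graph cycle, in cyclic order.  The size condition is
   needed because ucycle also accepts the empty sequence and, for adjacent u
   and v, the sequence [:: u; v]. *)
Definition is_cycle c := 2 < size c /\ ucycle (@edge G) c.

Definition super_nbr Y A : {set G} := [set y in Y | 2 <= #|nbr y :&: A|].

Definition super_cyclic X :=
  forall X' : {set G}, X' \subset X -> 3 <= #|X'| ->
  exists c, is_cycle c /\ [set v in c] :&: X = X'.

End Graph.

(* Membership of G in the class G(n, m, delta), witnessed by (X, Y). *)
Definition in_class (n m delta : nat) (G : sgraph) (X Y : {set G}) :=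
  [/\ bipartition X Y, #|X| = n, #|Y| = m &
      {in X, forall x, delta <= #|nbr x|}].

(* Main.v *)
Require Import Defs.
From mathcomp Require Import all_boot.
From mathcomp Require Import zify.

Set Implicit Arguments.
Unset Strict Implicit.
Unset Printing Implicit Defensive.

(* Take a minimal set A of n >= 4 vertices of X without a cycle through exactly A,
   so that every x in A is missed by a cycle C through the rest of A.  Let Z be
   the set of the n - 1 vertices of C in Y.  For a Hamiltonian path of A with ends
   u and v, rotating at both ends shows that u, v and the vertices r for which
   both ends can be joined around r pairwise have no common neighbor off the path;
   there are at least d(u) + d(v) - n such r, the degrees being taken on the path.
   Likewise x and the successors on C of its attachments to C pairwise have no
   common neighbor outside Z.  Since delta >= n and m <= 4 delta - 10, a set D of
   at least four vertices of A with this property satisfies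
   sum_(u in D) (n - d_Z(u)) <= 3 n - 9.

   If some x has at least four neighbors on such a cycle, choose x and C with the
   most; the previous inequalities, together with the super-neighborhood
   condition when d_Z(x) >= n - 2, give a contradiction.  Otherwise they bound by
   three the number of attachments of x to a cycle C on which x has as many
   neighbors as possible.  By Konig's theorem and 2-connectedness, x then shares
   with the other vertices of A, one of them possibly excepted, only neighbors in
   a set of at most three.  Four suitable vertices of A therefore have at least
   4 delta - 9 > m neighbors. *)

(** * Konig's theorem and finite sums *)

Definition is_cover (V W : finType) (E : {set V * W}) (L : {set V}) (R : {set W}) :=
  [forall p in E, (p.1 \in L) || (p.2 \in R)].

(* A minimal edge set with cover number at least [k] is a matching: if deleting
   two edges at a common endpoint leaves covers smaller than [k], then crossing
   these two covers yields one for the whole edge set. *)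
Lemma konig (V W : finType) (E : {set V * W}) k :
  (forall L R, is_cover E L R -> k <= #|L| + #|R|) ->
  exists M : {set V * W}, [/\ M \subset E, k <= #|M|,
    {in M &, injective fst} & {in M &, injective snd}].
Proof.
have [n] := ubnP #|E|; elim: n E => // n IHn E; rewrite ltnS => leEn coverE.
have [/existsP[p /andP[pE /forallP cE]]|/existsPn minE] := boolP
    [exists p in E, forall L : {set V}, forall R : {set W}, is_cover (E :\ p) L R ==> (k <= #|L| + #|R|)].
  have [|L R|M [sME leM inj1 inj2]] := IHn (E :\ p).
  - by rewrite (cardsD1 p E) pE in leEn.
  - by apply/implyP; move/forallP: (cE L); apply.
  by exists M; split=> //; apply: subset_trans sME (subD1set _ _).
have smallC p : p \in E -> exists (L : {set V}) (R : {set W}),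
    [/\ #|L| + #|R| < k, is_cover (E :\ p) L R, p.1 \notin L & p.2 \notin R].
  move=> pE; have := minE p; rewrite pE /= => /forallPn[L /forallPn[R]].
  rewrite negb_imply -ltnNge => /andP[cLR ltk]; exists L, R.
  suff: ~~ ((p.1 \in L) || (p.2 \in R)) by rewrite negb_or => /andP[].
  apply/negP => cp; move: ltk; rewrite ltnNge coverE //.
  apply/forall_inP => q qE; case: (eqVneq q p) => [-> //|qp].
  by apply: (forall_inP cLR); rewrite !inE qp.
have coverP p L R q : is_cover (E :\ p) L R -> q \in E -> q != p ->
    (q.1 \in L) || (q.2 \in R).
  by move=> /forall_inP cLR qE qp; apply: cLR; rewrite !inE qp.
exists E; split=> //.
- have := coverE [set p.1 | p in E] set0; rewrite cards0 addn0.
  move=> le_k; apply: leq_trans (le_k _) (leq_imset_card _ _).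
  by apply/forall_inP => p pE; rewrite imset_f.
- move=> p q pE qE pq1; apply/eqP/negPn/negP => pq.
  have [Lp [Rp [ltp cp p1 p2]]] := smallC p pE.
  have [Lq [Rq [ltq cq q1 q2]]] := smallC q qE.
  have := coverE (p.1 |: (Lp :|: Lq)) (Rp :&: Rq); rewrite cardsU1.
  have /[swap]/[apply] : is_cover E (p.1 |: (Lp :|: Lq)) (Rp :&: Rq).
    apply/forall_inP => r rE; rewrite !inE.
    case: (eqVneq r p) => [->|rp]; first by rewrite eqxx.
    case: (eqVneq r q) => [->|rq]; first by rewrite pq1 eqxx.
    case/orP: (coverP _ _ _ _ cp rE rp) => ->; rewrite ?orbT //.
    by case/orP: (coverP _ _ _ _ cq rE rq) => ->; rewrite ?orbT.
  have := coverE (Lp :&: Lq) (Rp :|: Rq).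
  have /[swap]/[apply] : is_cover E (Lp :&: Lq) (Rp :|: Rq).
    apply/forall_inP => r rE; rewrite !inE.
    case: (eqVneq r p) => [->|rp].
      by have := coverP _ _ _ _ cq pE pq; rewrite pq1 (negPf q1) /= => ->; rewrite ?orbT.
    case: (eqVneq r q) => [->|rq].
      have qp : q != p by rewrite eq_sym.
      by have := coverP _ _ _ _ cp qE qp; rewrite -pq1 (negPf p1) /= => ->; rewrite ?orbT.
    case/orP: (coverP _ _ _ _ cp rE rp) => ->; rewrite ?orbT //.
    by case/orP: (coverP _ _ _ _ cq rE rq) => ->; rewrite ?orbT.
  have := cardsUI Lp Lq; have := cardsUI Rp Rq; case: (_ \notin _); lia.
- move=> p q pE qE pq2; apply/eqP/negPn/negP => pq.
  have [Lp [Rp [ltp cp p1 p2]]] := smallC p pE.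
  have [Lq [Rq [ltq cq q1 q2]]] := smallC q qE.
  have := coverE (Lp :&: Lq) (p.2 |: (Rp :|: Rq)); rewrite cardsU1.
  have /[swap]/[apply] : is_cover E (Lp :&: Lq) (p.2 |: (Rp :|: Rq)).
    apply/forall_inP => r rE; rewrite !inE.
    case: (eqVneq r p) => [->|rp]; first by rewrite eqxx !orbT.
    case: (eqVneq r q) => [->|rq]; first by rewrite pq2 eqxx !orbT.
    case/orP: (coverP _ _ _ _ cp rE rp) => ->; rewrite ?orbT //.
    by case/orP: (coverP _ _ _ _ cq rE rq) => ->; rewrite ?orbT.
  have := coverE (Lp :|: Lq) (Rp :&: Rq).
  have /[swap]/[apply] : is_cover E (Lp :|: Lq) (Rp :&: Rq).
    apply/forall_inP => r rE; rewrite !inE.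
    case: (eqVneq r p) => [->|rp].
      by have := coverP _ _ _ _ cq pE pq; rewrite pq2 (negPf q2) orbF => ->; rewrite ?orbT.
    case: (eqVneq r q) => [->|rq].
      have qp : q != p by rewrite eq_sym.
      by have := coverP _ _ _ _ cp qE qp; rewrite -pq2 (negPf p2) orbF => ->.
    case/orP: (coverP _ _ _ _ cp rE rp) => ->; rewrite ?orbT //.
    by case/orP: (coverP _ _ _ _ cq rE rq) => ->; rewrite ?orbT.
  have := cardsUI Lp Lq; have := cardsUI Rp Rq; case: (_ \notin _); lia.
Qed.

Lemma sum_disjoint_le (I T : finType) (D : {set I}) (F : I -> {set T}) (B : {set T}) :
  {in D, forall i, F i \subset B} ->
  {in D &, forall i j, i != j -> [disjoint F i & F j]} ->
  \sum_(i in D) #|F i| <= #|B|.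
Proof.
move=> sFB disj.
have -> : \sum_(i in D) #|F i| = \sum_(i in D) \sum_(y in B) (y \in F i).
  apply: eq_bigr => i iD; rewrite -sum1_card [RHS](bigID (mem (F i))) /=.
  rewrite [X in _ + X]big1 ?addn0 => [|y /andP[_ /negPf-> //]].
  under [RHS]eq_bigr => y /andP[_ ->] do [].
  by apply: eq_bigl => y; rewrite andbC; case: (boolP (y \in F i)) => //= /(subsetP (sFB i iD))->.
rewrite exchange_big /= -sum1_card; apply: leq_sum => y _.
have [/exists_inP[i iD yi]|/exists_inPn no] := boolP [exists i in D, y \in F i].
  rewrite (bigD1 i) //= yi big1 // => j /andP[jD ji]; apply/eqP; rewrite eqb0.
  apply/negP => yj; have := disjointFr (disj j i jD iD ji) yj.
  by rewrite yi.
by rewrite big1 // => i iD; apply/eqP; rewrite eqb0 no.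
Qed.

(** Averaging over pairs: [leS] adds up the pairs through a fixed [s], and summing it over [s]
    leaves a factor [#|D|.-1] on both sides, positive because [1 < #|D|]. *)
Lemma sum_pairs_le (T : finType) (D : {set T}) (g : T -> nat) B : 1 < #|D| ->
  {in D &, forall s s', s != s' -> g s + g s' <= B} ->
  2 * \sum_(s in D) g s <= #|D| * B.
Proof.
move=> D1 gB; set S := \sum_(s in D) g s.
have leS s : s \in D -> #|D|.-1 * g s + S <= #|D|.-1 * B + g s.
  move=> sD; rewrite /S (bigD1 s) //=.
  have : \sum_(i in D | i != s) (g s + g i) <= \sum_(i in D | i != s) B.
    by apply: leq_sum => i /andP[iD is_]; rewrite gB // eq_sym.
  rewrite big_split /= !sum_nat_const.
  have -> : #|[pred i in D | i != s]| = #|D|.-1.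
    rewrite (cardsD1 s D) sD /=; apply: eq_card => i; rewrite !inE andbC //.
  lia.
have : \sum_(s in D) (#|D|.-1 * g s + S) <= \sum_(s in D) (#|D|.-1 * B + g s).
  exact: leq_sum.
rewrite !big_split /= !sum_nat_const -big_distrr /= -/S => le_S.
have : 2 * S * #|D|.-1 <= #|D| * B * #|D|.-1 by nia.
by rewrite leq_pmul2r //; lia.
Qed.

(** The length of a duplicate-free sequence is at most [#|V|], so its existence is a boolean. This
    serves to decide whether a cycle exists and to choose a best one. *)
Lemma uniq_exP (V : finType) (P : pred (seq V)) :
  reflect (exists2 c, uniq c & P c)
    [exists k : 'I_#|V|.+1, [exists t : k.-tuple V, uniq t && P t]].
Proof.
apply: (iffP existsP) => [[k /existsP[t /andP[Ut Pt]]]|[c Uc Pc]]; first by exists t.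
have szc : size c < #|V|.+1 by rewrite ltnS -(card_uniqP Uc) max_card.
by exists (Ordinal szc); apply/existsP; exists (in_tuple c); rewrite Uc.
Qed.

(** * Sequences, paths and cycles *)

Section Sequences.
Variables (V : eqType) (e : rel V).
Hypothesis e_sym : symmetric e.

Lemma rev_sorted_sym s : sorted e (rev s) = sorted e s.
Proof. by rewrite rev_sorted; case: s => //= a s; apply: eq_path => ? ?. Qed.

Lemma sorted_cat x s1 s2 :
  sorted e s1 -> sorted e s2 -> e (last x s1) (head x s2) -> sorted e (s1 ++ s2).
Proof.
case: s1 => [|a s1] //= es1; case: s2 => [|b s2] //=; first by rewrite cats0.
by rewrite cat_path es1 /= => -> ->.
Qed.

Lemma cycle_cat x s1 s2 : s1 != [::] -> s2 != [::] ->
  sorted e s1 -> sorted e s2 ->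
  e (last x s1) (head x s2) -> e (last x s2) (head x s1) -> cycle e (s1 ++ s2).
Proof.
case: s1 => [|a s1] //; case: s2 => [|b s2] // _ _ /= es1 es2 e12 e21.
by rewrite rcons_path cat_path last_cat es1 /= e12 es2.
Qed.

Lemma head_rev x (s : seq V) : head x (rev s) = last x s.
Proof. by case/lastP: s => // s a; rewrite rev_rcons last_rcons. Qed.

Lemma last_rev x (s : seq V) : last x (rev s) = head x s.
Proof. by rewrite -head_rev revK. Qed.

Lemma next_cat x p1 (a : V) p2 : uniq (p1 ++ a :: p2) -> p2 != [::] ->
  next (p1 ++ a :: p2) a = head x p2.
Proof.
move=> Up; rewrite -(next_rot (size p1) Up) rot_size_cat.
by case: p2 {Up} => //= b p2 _; rewrite eqxx.
Qed.

Lemma prev_cat x p1 (a : V) p2 : uniq (p1 ++ a :: p2) -> p1 != [::] ->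
  prev (p1 ++ a :: p2) a = last x p1.
Proof.
move=> Up p1n; rewrite -next_rev // rev_cat rev_cons cat_rcons.
rewrite (@next_cat x) ?head_rev //; last first.
  by case/lastP: p1 p1n {Up} => // p b _; rewrite rev_rcons.
by rewrite -cat_rcons -rev_cons -rev_cat rev_uniq.
Qed.

(** An added edge from the last vertex to the first makes the path a cycle, to which [next_cycle]
    and [prev_cycle] apply. *)
Lemma sorted_cycle_closed Q x : sorted e Q ->
  cycle [rel a b | e a b || (a == last x Q) && (b == head x Q)] Q.
Proof.
case: Q => //= a q eq; rewrite rcons_path /= !eqxx orbT andbT.
by apply: sub_path eq => b d /= ->.
Qed.

Lemma sorted_next Q x a : sorted e Q -> a \in Q -> a != last x Q ->
  e a (next Q a).
Proof.
move=> /(sorted_cycle_closed x) cQ aQ /negPf al.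
by have /= := next_cycle cQ aQ; rewrite al orbF.
Qed.

Lemma sorted_prev Q x a : sorted e Q -> a \in Q -> a != head x Q ->
  e (prev Q a) a.
Proof.
move=> /(sorted_cycle_closed x) cQ aQ /negPf al.
by have /= := prev_cycle cQ aQ; rewrite al andbF orbF.
Qed.

Lemma next_rot_cons x c i (y : V) p : uniq c -> rot i c = y :: p -> p != [::] ->
  next c y = head x p.
Proof.
move=> Uc def_c pn; have Up : uniq (y :: p) by rewrite -def_c rot_uniq.
by rewrite -(next_rot i Uc) def_c (next_cat x (p1 := [::])).
Qed.

Lemma prev_rot_cons x c i (y : V) p : uniq c -> rot i c = y :: p -> p != [::] ->
  prev c y = last x p.
Proof.
move=> Uc def_c pn; have Up : uniq (y :: p) by rewrite -def_c rot_uniq.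
rewrite -(prev_rot i Uc) def_c -(prev_rot 1 Up) rot1_cons -cats1.
by rewrite (@prev_cat x) // cats1 -rot1_cons rot_uniq.
Qed.

Lemma next_rot_cat x c i p1 (y : V) p2 : uniq c -> rot i c = p1 ++ y :: p2 ->
  p2 != [::] -> next c y = head x p2.
Proof.
by move=> Uc def_c p2n; rewrite -(next_rot i Uc) def_c (next_cat x) // -def_c rot_uniq.
Qed.

Lemma prev_rot_cat x c i p1 (y : V) p2 : uniq c -> rot i c = p1 ++ y :: p2 ->
  p1 != [::] -> prev c y = last x p1.
Proof.
by move=> Uc def_c p2n; rewrite -(prev_rot i Uc) def_c (prev_cat x) // -def_c rot_uniq.
Qed.
End Sequences.

(** * Rotations of Hamiltonian paths *)

Section CriticalBigraph.
Variables (V : finType) (e : rel V) (A : {set V}).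
Hypothesis e_sym : symmetric e.
Hypothesis e_bip : forall u v, e u v -> (u \in A) (+) (v \in A).
Hypothesis noham : forall c, ucycle e c -> {subset A <= c} -> False.

Let N u := [set v | e u v].
Let outer (p : seq V) := [set z in p | z \notin A].

Lemma bip_notin u v : e u v -> u \in A -> v \notin A.
Proof. by move/e_bip; case: (u \in A) => //= /negbTE->. Qed.

Lemma bip_in u v : e u v -> u \notin A -> v \in A.
Proof. by move/e_bip; case: (u \in A). Qed.

(** With the defaults [u] and [v] the empty sequence passes both end conditions; [ham_path_nil]
    rules it out when [u \in A]. *)
Definition ham_path u v Q :=
  [/\ sorted e Q, uniq Q, {subset A <= Q}, head u Q = u & last v Q = v].

Lemma ham_path_nil u v Q : u \in A -> ham_path u v Q -> Q != [::].
Proof. by move=> uA [_ _ sAQ _ _]; apply/eqP => Q0; have := sAQ u uA; rewrite Q0. Qed.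

Lemma ham_path_head u v Q x : u \in A -> ham_path u v Q -> head x Q = u.
Proof.
move=> uA hQ; have := ham_path_nil uA hQ.
by case: hQ => _ _ _; case: Q.
Qed.

Lemma ham_path_last u v Q x : u \in A -> ham_path u v Q -> last x Q = v.
Proof.
move=> uA hQ; have := ham_path_nil uA hQ.
by case: hQ => _ _ _ _; case: Q.
Qed.

Lemma ham_path_close u v Q b : u \in A -> ham_path u v Q ->
  e u b -> e v b -> b \in Q.
Proof.
move=> uA hQ eub evb; apply/negPn/negP => bQ.
have [eQ UQ sAQ _ _] := hQ.
apply: (noham (c := b :: Q)); last by move=> a /sAQ aQ; rewrite inE aQ orbT.
rewrite /ucycle cons_uniq bQ UQ !andbT.
rewrite -[cycle e _]/(cycle e ([:: b] ++ Q)).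
apply: (cycle_cat (x := b)) => //=; first exact: ham_path_nil hQ.
  by rewrite (ham_path_head _ uA hQ) e_sym.
by rewrite (ham_path_last _ uA hQ).
Qed.

(** The middle segment [q2] stays and both outer segments are reversed: [u] is then followed by the
    head of [q2], and [v] preceded by its last vertex. *)
Lemma rotate_both_ends u v Q p1 a q2 b p3 : u \in A -> ham_path u v Q ->
  Q = rcons p1 a ++ q2 ++ b :: p3 -> q2 != [::] ->
  e u (head u q2) -> e v (last u q2) ->
  ham_path a b (rev (rcons p1 a) ++ q2 ++ rev (b :: p3)).
Proof.
move=> uA hQ def_Q q2n euz evz; have [eQ UQ sAQ _ _] := hQ.
have hd := ham_path_head a uA hQ; have lt := ham_path_last u uA hQ.
rewrite def_Q in eQ UQ sAQ hd lt.
have [e1 /cat_sorted2[e2 e3]] := cat_sorted2 eQ.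
have mem_new z : (z \in rev (rcons p1 a) ++ q2 ++ rev (b :: p3)) =
                 (z \in rcons p1 a ++ q2 ++ b :: p3).
  by rewrite !mem_cat !mem_rev.
split=> //.
- apply: (sorted_cat (x := u)); rewrite ?rev_sorted_sym //.
    apply: (sorted_cat (x := u)); rewrite ?rev_sorted_sym //.
    rewrite head_rev; move: lt; rewrite !last_cat /= => ->; by rewrite e_sym.
  rewrite last_rev; case: (q2) q2n euz => //= z q _.
  by move: hd; rewrite headI /= => ->.
- rewrite -(perm_uniq (s1 := rcons p1 a ++ q2 ++ b :: p3)) //.
  by rewrite perm_cat // ?perm_cat // perm_sym perm_rev.
- by move=> z /sAQ; rewrite mem_new.
- by rewrite rev_rcons.
- by rewrite !last_cat last_rev.
Qed.

Lemma not_edge u v : u \in A -> v \in A -> e u v = false.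
Proof. by move=> uA vA; apply/negP => /bip_notin/(_ uA); rewrite vA. Qed.

(** Rotating at both ends makes [a] and [b] the ends of a Hamiltonian path on the same vertices, and
    [ham_path_close] applies to it. *)
Lemma rotate_common u v Q a b y : u \in A -> ham_path u v Q ->
  a \in A -> b \in A -> a != b -> index a Q < index b Q ->
  e u (next Q a) -> e v (prev Q b) -> e a y -> e b y -> y \in Q.
Proof.
move=> uA hQ aA bA ab lt_ab eua evb eay eby.
have [eQ UQ sAQ _ _] := hQ.
have aQ := sAQ a aA; have bQ := sAQ b bA.
case/splitPr: aQ eQ UQ hQ lt_ab eua evb bQ => p1 p2 eQ UQ hQ lt_ab eua evb bQ.
have bp2 : b \in p2.
  move: bQ UQ lt_ab; rewrite mem_cat inE eq_sym (negbTE ab) /=.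
  rewrite cat_uniq => /orP[bp1|//] /and3P[_ /hasPn/(_ a)].
  rewrite inE eqxx => /(_ isT) /= ap1 _.
  by rewrite !index_cat bp1 (negbTE ap1) /= eqxx addn0 ltnNge index_size.
case/splitPr: bp2 eQ UQ hQ {lt_ab bQ} eua evb => q2 p3 eQ UQ hQ eua evb.
(* Vertices of [A] are never adjacent, hence never consecutive on [Q]. *)
have q2n : q2 != [::].
  apply/eqP => q20; move: eQ; rewrite q20 sorted_cat_cons /=.
  by rewrite (not_edge aA bA) andbF.
have := rotate_both_ends uA hQ (p1 := p1) (a := a) (q2 := q2) (b := b) (p3 := p3).
rewrite cat_rcons => /(_ erefl q2n).
have -> : head u q2 = next (p1 ++ a :: q2 ++ b :: p3) a.
  by rewrite (next_cat u) //; case: (q2) q2n.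
have -> : last u q2 = prev (p1 ++ a :: q2 ++ b :: p3) b.
  rewrite -cat_cons catA (prev_cat u) -?catA ?cat_cons //.
    by rewrite last_cat /=; case: (q2) q2n.
  by case: (p1).
move=> /(_ eua evb) hQ'; have := ham_path_close aA hQ' eay eby.
rewrite !(mem_cat, mem_rev, mem_rcons, inE).
by case: (y == a); case: (y \in p1) => //=; rewrite ?orbT //= => ->; rewrite ?orbT.
Qed.

(* The vertices [r] such that the two ends of [Q] can be joined around [r], so
   that a cycle omits only [r] and uses the same vertices outside [A] as [Q]. *)
Definition swappable u v Q := [set r in A | e u (next Q r) && e v (prev Q r)].

(** Since [next] and [prev] are cyclic, a swappable end would force a loop at the other end. *)
Lemma swappable_end u v Q : u \in A -> v \in A -> ham_path u v Q ->
  (u \notin swappable u v Q) && (v \notin swappable u v Q).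
Proof.
move=> uA vA hQ; have [eQ UQ sAQ _ _] := hQ; rewrite !inE.
have := ham_path_nil uA hQ; have := ham_path_head u uA hQ;
have := ham_path_last u uA hQ.
case: Q UQ {eQ sAQ hQ} => // w Q UQ lv wu _.
rewrite /= in lv wu; rewrite wu in UQ lv *.
case: (eqVneq Q [::]) lv => [-> /= uv | Qn lv].
  by rewrite uv !eqxx !(not_edge vA vA) !andbF.
have -> : prev (u :: Q) u = v.
  by rewrite (prev_rot_cons u (i := 0) UQ (rot0 _)) // -lv; case: (Q) Qn.
have -> : next (u :: Q) v = u.
  have Qv : rcons (belast u Q) v = u :: Q by rewrite -lv -lastI.
  rewrite (next_rot_cons u (i := size (belast u Q)) UQ (p := belast u Q)) //.
  - by case: (Q) Qn.
  - by rewrite -Qv -cats1 rot_size_cat.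
  - by case: (Q) Qn.
by rewrite (not_edge vA vA) (not_edge uA uA) !andbF.
Qed.

(** If [a] precedes [b] on [Q], then [a] is not [v] and [b] is not [u], so [u] is adjacent to
    [next Q a] and [v] to [prev Q b]; [rotate_common] concludes. *)
Lemma swappable_indep u v Q : u \in A -> v \in A -> ham_path u v Q ->
  {in v |: (u |: swappable u v Q) &, forall a b, a != b ->
     forall y, e a y -> e b y -> y \in outer Q}.
Proof.
move=> uA vA hQ; have [eQ UQ sAQ _ _] := hQ.
set R := v |: _.
have RA a : a \in R -> a \in A.
  by rewrite !inE => /or3P[/eqP-> | /eqP-> | /andP[]].
have Rnext a : a \in R -> a != v -> e u (next Q a).
  rewrite !inE => /or3P[/eqP-> | /eqP-> | /and3P[]] //; first by rewrite eqxx.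
  move=> uv; apply: (sorted_next (x := u)) => //; first exact: sAQ.
  by rewrite (ham_path_last _ uA hQ).
have Rprev a : a \in R -> a != u -> e v (prev Q a).
  rewrite !inE => /or3P[/eqP-> | /eqP-> | /and3P[]] //; last by rewrite eqxx.
  move=> uv; rewrite e_sym; apply: (sorted_prev (x := u)) => //; first exact: sAQ.
  by rewrite (ham_path_head _ uA hQ).
have indu a : a \in Q -> a != u -> 0 < index a Q.
  move=> aQ; have := ham_path_head u uA hQ; case: (Q) aQ => //= w s _ ->.
  by rewrite eq_sym => /negPf ->.
have wlog_ab a b : a \in R -> b \in R -> a != b -> index a Q < index b Q ->
    forall y, e a y -> e b y -> y \in outer Q.
  move=> aR bR ab lt_ab y eay eby.
  rewrite inE (bip_notin eay (RA a aR)) andbT.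
  apply: (rotate_common uA hQ (RA a aR) (RA b bR) ab lt_ab _ _ eay eby).
    apply: Rnext => //; apply: contraTneq lt_ab => ->.
    rewrite -leqNgt -ltnS.
    have lv := ham_path_last u uA hQ.
    have sz : size Q = (index v Q).+1.
      have Qn := ham_path_nil uA hQ.
      by case: (Q) Qn UQ lv => // w s _ Us <-; rewrite [last u _]/= index_last.
    have := index_mem b Q; rewrite (sAQ b (RA b bR)) sz ltnS; lia.
  apply: Rprev => //; apply: contraTneq lt_ab => ->.
  have hu := ham_path_head u uA hQ; have Qn := ham_path_nil uA hQ.
  by case: (Q) Qn hu => //= w s _ ->; rewrite eqxx.
move=> a b aR bR ab y eay eby.
have [lt_ab|gt_ab|eq_ab] := ltngtP (index a Q) (index b Q).
- exact: (wlog_ab a b).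
- by apply: (wlog_ab b a) => //; rewrite eq_sym.
- have aQ := sAQ a (RA a aR); have bQ := sAQ b (RA b bR).
  by move: ab; rewrite -(nth_index u aQ) eq_ab nth_index ?eqxx.
Qed.

(** Removing [r] splits [Q] into [p1] and [p2]; the cycle is [p1 ++ rev p2], closed by the two edges
    that make [r] swappable. *)
Lemma swappable_cycle u v Q r : u \in A -> v \in A -> ham_path u v Q ->
  r \in swappable u v Q ->
  exists c, [/\ ucycle e c, forall a, a \in A -> (a \in c) = (a != r)
              & outer c = outer Q].
Proof.
move=> uA vA hQ rR; have [eQ UQ sAQ _ _] := hQ.
have /andP[uR vR] := swappable_end uA vA hQ.
have ru : r != u by apply: contraNneq uR => E; rewrite -{1}E.
have rv : r != v by apply: contraNneq vR => E; rewrite -{1}E.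
have hd := ham_path_head r uA hQ; have lt := ham_path_last r uA hQ.
move: rR; rewrite inE => /and3P[rA eun evp].
have rQ := sAQ r rA; case/splitPr: rQ eQ UQ sAQ {hQ uR vR} hd lt eun evp
  => p1 p2 eQ UQ sAQ hd lt.
have p1n : p1 != [::] by apply: contraNneq ru => p10; rewrite -hd p10.
have p2n : p2 != [::] by apply: contraNneq rv => p20; rewrite -lt p20 last_cat.
rewrite (next_cat r) // (prev_cat r) // => eun evp.
have [e1 e2] := cat_sorted2 eQ; have {}e2 := path_sorted e2.
exists (p1 ++ rev p2); split.
- rewrite /ucycle; apply/andP; split.
    apply: (cycle_cat (x := r)) => //.
    + by rewrite -size_eq0 size_rev size_eq0.
    + by rewrite rev_sorted_sym.
    + rewrite head_rev e_sym; suff -> : last r p2 = v by [].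
      by move: lt; rewrite last_cat.
    + rewrite last_rev e_sym; suff -> : head r p1 = u by [].
      by case: (p1) p1n hd.
  rewrite -(perm_uniq (s1 := p1 ++ p2)); last by rewrite perm_cat // perm_sym perm_rev.
  by move: UQ; rewrite -[r :: p2]cat1s uniq_catCA cat_uniq => /and3P[].
- move=> a aA; rewrite mem_cat mem_rev; have := sAQ a aA.
  rewrite mem_cat inE; case: eqVneq => //= [-> _].
  move: UQ; rewrite -[r :: p2]cat1s uniq_catCA /= mem_cat => /andP[+ _].
  by move/negPf.
- apply/setP=> z; rewrite !inE !mem_cat mem_rev inE.
  by case: eqVneq => //= ->; rewrite rA !andbF.
Qed.

(** Ore's argument: the neighbors of [u] shifted back and those of [v] shifted forward along [Q] are
    two subsets of [A] which meet in the swappable vertices. *)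
Lemma degree_sum_le u v Q : u \in A -> v \in A -> ham_path u v Q ->
  #|N u :&: outer Q| + #|N v :&: outer Q| <= #|A| + #|swappable u v Q|.
Proof.
move=> uA vA hQ; have [eQ UQ sAQ _ _] := hQ.
pose P1 := [set r in A | e u (next Q r)]; pose P2 := [set r in A | e v (prev Q r)].
have -> : swappable u v Q = P1 :&: P2.
  by apply/setP=> r; rewrite !inE; case: (r \in A).
have le1 : #|N u :&: outer Q| <= #|P1|.
  rewrite -(card_imset _ (can_inj (next_prev UQ))).
  apply/subset_leq_card/subsetP => _ /imsetP[z + ->]; rewrite !inE.
  case/and3P=> euz zQ zA; rewrite (next_prev UQ) euz andbT.
  apply: (bip_in _ zA); rewrite e_sym; apply: (sorted_prev (x := u)) => //.
  by rewrite (ham_path_head _ uA hQ); apply: contraNneq zA => ->.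
have le2 : #|N v :&: outer Q| <= #|P2|.
  rewrite -(card_imset _ (can_inj (prev_next UQ))).
  apply/subset_leq_card/subsetP => _ /imsetP[z + ->]; rewrite !inE.
  case/and3P=> euz zQ zA; rewrite (prev_next UQ) euz andbT.
  apply: (bip_in _ zA); apply: (sorted_next (x := u)) => //.
  by rewrite (ham_path_last _ uA hQ); apply: contraNneq zA => ->.
have := cardsUI P1 P2.
have : #|P1 :|: P2| <= #|A|.
  by apply/subset_leq_card; rewrite subUset; apply/andP; split;
     apply/subsetP => r; rewrite inE => /andP[].
lia.
Qed.

(** * Cycles missing one vertex of [A], and attachments to them *)

Definition cycle_missing x c :=
  ucycle e c /\ forall a, a \in A -> (a \in c) = (a != x).

(** The cycle alternates: [prev] and [next] inject the outer vertices and [A :\ x] into each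
    other. *)
Lemma card_outer_cycle x c : x \in A -> cycle_missing x c ->
  #|outer c| = #|A|.-1.
Proof.
move=> xA [/andP[ec Uc] cA].
rewrite (cardsD1 x A) xA /=; apply/eqP; rewrite eqn_leq; apply/andP; split.
  rewrite -(card_imset _ (can_inj (prev_next Uc))).
  apply/subset_leq_card/subsetP => _ /imsetP[a + ->]; rewrite !inE => /andP[ac aA].
  have nA : next c a \in A by apply: (bip_in _ aA); exact: next_cycle.
  by rewrite nA andbT -cA // mem_next.
rewrite -(card_imset _ (can_inj (prev_next Uc))).
apply/subset_leq_card/subsetP => _ /imsetP[a + ->]; rewrite !inE => /andP[ax aA].
have ac : a \in c by rewrite cA.
by rewrite mem_next ac (bip_notin (next_cycle ec ac)).
Qed.

Lemma rot_outer x c y : ucycle e c -> y \in c -> y \notin A ->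
  exists i p, [/\ rot i c = y :: p, p != [::] & sorted e p] /\
    [/\ next c y = head x p, prev c y = last x p, y \notin p, uniq p
      & forall z, (z \in c) = (z == y) || (z \in p)].
Proof.
move=> /andP[ec Uc] yc yA; have [i p def_c] := rot_to yc; exists i, p.
have Up : uniq (y :: p) by rewrite -def_c rot_uniq.
have ep : cycle e (y :: p) by rewrite -def_c rot_cycle.
have pn : p != [::].
  by apply: contraTneq ep => -> /=; apply/negP => /andP[/e_bip]; rewrite (negPf yA).
have [yp {}Up] := andP Up; split; split => //.
- by move: ep => /=; rewrite rcons_path => /andP[/path_sorted].
- exact: next_rot_cons def_c pn.
- exact: prev_rot_cons def_c pn.
- by move=> z; rewrite -(mem_rot i) def_c inE.
Qed.

(* Two distinct links [w] and [b] would let [x] be inserted in the gap [y]. *)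
Lemma insert_vertex x c y w b : x \in A -> cycle_missing x c ->
  y \in c -> y \notin A -> e x w -> e (prev c y) w -> (w == y) || (w \notin c) ->
  e x b -> e (next c y) b -> (b == y) || (b \notin c) -> b = w.
Proof.
move=> xA [cc cA] yc yA exw epw wc exb enb bc; apply/eqP; apply/negPn/negP => bw.
have [i [p [[_ pn ep] [def_n def_p yp Up mem_c]]]] := rot_outer x cc yc yA.
have wA := bip_notin exw xA; have bA := bip_notin exb xA.
have out z : z \notin A -> (z == y) || (z \notin c) -> z \notin p.
  by move=> zA; rewrite mem_c; case: eqVneq => [->|].
have xp : x \notin p.
  have : x \notin c by rewrite cA // eqxx.
  by apply: contraNN => xp; rewrite mem_c xp orbT.
apply: (noham (c := p ++ [:: w; x; b])).
  apply/andP; split.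
    apply: (cycle_cat (x := x)) => //=.
    - by rewrite e_sym exw exb.
    - by rewrite -def_p.
    - by rewrite -def_n e_sym.
  have wx : w != x by apply: contraNneq wA => ->.
  have xb : x != b by apply: contraNneq bA => <-.
  rewrite cat_uniq Up /= !inE !negb_or wx xb [w == b]eq_sym bw.
  by rewrite (out _ wA wc) (out _ bA bc) (negPf xp).
move=> a aA; rewrite mem_cat !inE; have := cA a aA; rewrite mem_c.
case: (eqVneq a y) => [ay|_ /= ->]; first by rewrite -ay aA in yA.
by case: eqVneq; rewrite ?orbT.
Qed.

(* [(w, y)] records that [x] is linked through [w] to the vertex preceding the
   gap [y] of the cycle; [w] is [y] itself or lies off the cycle. *)
Definition attach x c w y :=
  [/\ y \in c, y \notin A, e x w, e (prev c y) w &
      (w == y) || (w \notin c) && ~~ e (next c y) w].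

Lemma attach_free x c w y : attach x c w y -> (w == y) || (w \notin c).
Proof. by case=> _ _ _ _ /orP[->|/andP[-> _]]; rewrite ?orbT. Qed.

(** Off the cycle, [insert_vertex] would give [b = w]; but [w] is either [y], on the cycle, or not
    adjacent to [next c y]. *)
Lemma attach_indep_missing x c w y b : x \in A -> cycle_missing x c ->
  attach x c w y -> e x b -> e (next c y) b -> b \in outer c.
Proof.
move=> xA cx aw exb enb; rewrite inE (bip_notin exb xA) andbT.
apply/negPn/negP => bc; have [yc yA exw epw /orP wP] := aw.
have bw := insert_vertex xA cx yc yA exw epw (attach_free aw) exb enb.
rewrite bc orbT in bw; have {}bw := bw isT.
case: wP => [/eqP wy|/andP[_ /negP[]]]; last by rewrite -bw.
by rewrite bw wy yc in bc.
Qed.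

(** Deleting [y] and [y'] leaves arcs [p1] and [p2], starting at the two successors. Their far ends
    are joined through [w'], [x], [w]. *)
Lemma attach_path x c w y w' y' : x \in A -> cycle_missing x c ->
  attach x c w y -> attach x c w' y' -> y != y' -> w != w' ->
  exists Q, ham_path (next c y) (next c y') Q /\
    forall z, (z \in Q) =
      [|| z == w, z == w', z == x | [&& z \in c, z != y & z != y']].
Proof.
move=> xA [cc cA] aw aw' yy' ww'.
have [[yc yA exw epw _] [yc' yA' exw' epw' _]] := (aw, aw').
have [ec Uc] := andP cc.
have [i p1 p2 _ _ def_c] := rot_to_arc Uc yc yc' yy'.
have Up : uniq (y :: p1 ++ y' :: p2) by rewrite -def_c rot_uniq.
have ep : cycle e (y :: p1 ++ y' :: p2) by rewrite -def_c rot_cycle.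
have mem_c z : (z \in c) = (z \in y :: p1 ++ y' :: p2) by rewrite -def_c mem_rot.
have p1n : p1 != [::].
  by apply: contraTneq ep => -> /=; apply/negP => /andP[/e_bip];
     rewrite (negPf yA) (negPf yA').
have p2n : p2 != [::].
  apply: contraTneq ep => -> /=; apply/negP.
  by rewrite rcons_path last_cat => /andP[_ /e_bip]; rewrite /= (negPf yA) (negPf yA').
have def_n : next c y = head x p1.
  by rewrite (next_rot_cons x Uc def_c) //; case: (p1) p1n.
have def_p : prev c y = last x p2.
  by rewrite (prev_rot_cons x Uc def_c) ?last_cat //=; [case: (p2) p2n | case: (p1)].
have def_n' : next c y' = head x p2.
  by rewrite (next_rot_cat x Uc (i := i) (p1 := y :: p1) (p2 := p2)).
have def_p' : prev c y' = last x p1.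
  by rewrite (prev_rot_cat x Uc (i := i) (p1 := y :: p1) (p2 := p2)) //=; case: (p1) p1n.
have wA := bip_notin exw xA; have wA' := bip_notin exw' xA.
have [e1 e2] : sorted e p1 /\ sorted e p2.
  move: ep; rewrite /= rcons_path cat_path => /andP[/andP[/path_sorted-> /=]].
  by case/andP=> _ /path_sorted.
have [[yp1 yp2 yp1' yp2'] [U1 U2 U12]] :
    [/\ y \notin p1, y \notin p2, y' \notin p1 & y' \notin p2] /\
    [/\ uniq p1, uniq p2 & ~~ has (mem p1) p2].
  move: Up; rewrite /= mem_cat inE cat_uniq /= !negb_or.
  by case/andP=> /and3P[-> _ ->] /and4P[-> /andP[-> ->] -> ->].
have out z : z \notin A -> [|| z == y, z == y' | z \notin c] ->
    (z \notin p1) && (z \notin p2).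
  move=> zA; rewrite mem_c inE mem_cat inE.
  case: (eqVneq z y) => [->|_]; first by rewrite yp1 yp2.
  by case: (eqVneq z y') => [->|_] /=; rewrite ?yp1' ?yp2' // negb_or.
have xc : x \notin c by rewrite cA // eqxx.
have xp : (x \notin p1) && (x \notin p2).
  by move: xc; rewrite mem_c inE mem_cat inE !negb_or => /and4P[_ -> _ ->].
have wp : (w \notin p1) && (w \notin p2).
  by apply: out => //; case/orP: (attach_free aw) => ->; rewrite ?orbT.
have wp' : (w' \notin p1) && (w' \notin p2).
  by apply: out => //; case/orP: (attach_free aw') => ->; rewrite ?orbT.
exists (p1 ++ [:: w'; x; w] ++ rev p2).
have mem_Q z : (z \in p1 ++ [:: w'; x; w] ++ rev p2) =
      [|| z == w, z == w', z == x | [&& z \in c, z != y & z != y']].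
  rewrite mem_c !(mem_cat, inE, mem_rev).
  case: (eqVneq z y) => [->|_] /=.
    by rewrite (negPf yp1) (negPf yp2) !orbF; case: (y == w); case: (y == w'); case: (y == x).
  case: (eqVneq z y') => [->|_] /=.
    by rewrite (negPf yp1') (negPf yp2') !orbF; case: (y' == w); case: (y' == w'); case: (y' == x).
  rewrite !andbT; case: (z == w); case: (z == w'); case: (z == x); by rewrite /= ?orbT.
split=> //; split.
- apply: (sorted_cat (x := x)) => //=; last by rewrite -def_p'.
  rewrite e_sym exw' exw -[path _ _ _]/(sorted e ([:: w] ++ rev p2)).
  apply: (sorted_cat (x := x)); rewrite ?rev_sorted_sym //= head_rev -def_p.
  by rewrite e_sym.
- rewrite cat_uniq /= rev_uniq U1 U2 !inE !mem_rev !negb_or.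
  case/andP: xp => -> ->; case/andP: wp => -> ->; case/andP: wp' => -> ->.
  have -> : w' != x by apply: contraNneq wA' => ->.
  have -> : x != w by apply: contraNneq wA => <-.
  by rewrite eq_sym ww' has_rev U12.
- move=> a aA; rewrite mem_Q (cA a aA); case: (eqVneq a x) => [|_]; first by rewrite !orbT.
  have -> : a != y by apply: contraNneq yA => <-.
  have -> : a != y' by apply: contraNneq yA' => <-.
  by rewrite !orbT.
- by rewrite def_n; case: (p1) p1n.
- by rewrite !last_cat last_rev def_n'; case: (p2) p2n.
Qed.

(** Both successors are the ends of the path of [attach_path], so [b] lies on it; the last clause of
    [attach] keeps [b] from being an off-cycle [w] or [w']. *)
Lemma attach_indep x c w y w' y' b : x \in A -> cycle_missing x c ->
  attach x c w y -> attach x c w' y' -> y != y' -> w != w' ->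
  e (next c y) b -> e (next c y') b -> b \in outer c.
Proof.
move=> xA cx aw aw' yy' ww' enb enb'.
have [[yc yA _ _ wP] [yc' _ _ _ wP']] := (aw, aw').
have [Q [hQ mem_Q]] := attach_path xA cx aw aw' yy' ww'.
have nA : next c y \in A.
  by apply: bip_in yA; apply: next_cycle => //; case: cx => /andP[].
rewrite inE (bip_notin enb nA) andbT.
have := ham_path_close nA hQ enb enb'; rewrite mem_Q => /or4P[|||/and3P[]//].
- by move/eqP=> bw; move: wP; rewrite -bw enb andbF orbF => /eqP->.
- by move/eqP=> bw; move: wP'; rewrite -bw enb' andbF orbF => /eqP->.
- by move/eqP=> bx; move: (bip_notin enb nA); rewrite bx xA.
Qed.

Lemma attach_gap x c y : cycle_missing x c -> y \in c -> y \notin A -> e x y ->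
  attach x c y y.
Proof.
by move=> [/andP[ec _] _] yc yA exy; split=> //; [exact: prev_cycle | rewrite eqxx].
Qed.

(** For [a] other than [x], the gap [prev c a] is an attachment through itself; [attach_indep] and
    [attach_indep_missing] cover the cases. *)
Lemma succ_indep x c a b z : x \in A -> cycle_missing x c ->
  a \in A -> b \in A -> a != b ->
  (a == x) || e x (prev c a) -> (b == x) || e x (prev c b) ->
  e a z -> e b z -> z \in outer c.
Proof.
move=> xA cx aA bA ab ax bx eaz ebz; have [/andP[ec Uc] cA] := cx.
have att d : d \in A -> d != x -> e x (prev c d) -> attach x c (prev c d) (prev c d).
  move=> dA dx exd; apply: attach_gap => //; first by rewrite mem_prev cA.
  exact: bip_notin exd xA.
have [xx|anx] := eqVneq a x.
  rewrite xx in ax ab eaz; rewrite eq_sym (negPf ab) in bx.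
  apply: (attach_indep_missing xA cx (att b bA _ bx) eaz); first by rewrite eq_sym.
  by rewrite next_prev.
rewrite (negPf anx) /= in ax; have [xx|bnx] := eqVneq b x.
  apply: (attach_indep_missing xA cx (att a aA anx ax) (b := z)); first by rewrite -xx.
  by rewrite next_prev.
rewrite (negPf bnx) /= in bx.
have pab : prev c a != prev c b by rewrite (can_eq (next_prev Uc)).
by apply: (attach_indep xA cx (att a aA anx ax) (att b bA bnx bx)) => //; rewrite next_prev.
Qed.

Lemma cycle_missing_rev x c : cycle_missing x c -> cycle_missing x (rev c).
Proof.
move=> [/andP[ec Uc] cA]; split; last by move=> a /cA <-; rewrite mem_rev.
rewrite /ucycle rev_uniq Uc rev_cycle andbT.
by case: (c) ec => //= a s; rewrite (eq_path (e' := e)).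
Qed.

Lemma pred_indep x c a b z : x \in A -> cycle_missing x c ->
  a \in A -> b \in A -> a != b ->
  (a == x) || e x (next c a) -> (b == x) || e x (next c b) ->
  e a z -> e b z -> z \in outer c.
Proof.
move=> xA cx aA bA ab ax bx eaz ebz; have [/andP[_ Uc] _] := cx.
have -> : outer c = outer (rev c) by apply/setP=> d; rewrite !inE mem_rev.
apply: (succ_indep xA (cycle_missing_rev cx) aA bA ab); rewrite ?prev_rev //.
Qed.

(** The vertex [x] takes the place of [s] between its two cycle neighbors. *)
Lemma exchange_missing x c s : x \in A -> cycle_missing x c -> s \in A -> s != x ->
  e x (prev c s) -> e x (next c s) ->
  exists2 c', cycle_missing s c' & outer c' = outer c.
Proof.
move=> xA [/andP[ec Uc] cA] sA sx exp exn.
have sc : s \in c by rewrite cA.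
have [i p def_c] := rot_to sc.
have Up : uniq (s :: p) by rewrite -def_c rot_uniq.
have ep : cycle e (s :: p) by rewrite -def_c rot_cycle.
have pn : p != [::].
  by apply: contraTneq ep => -> /=; rewrite (not_edge sA sA).
have mem_c z : (z \in c) = (z == s) || (z \in p) by rewrite -(mem_rot i) def_c inE.
have xp : x \notin p.
  have : x \notin c by rewrite cA // eqxx.
  by apply: contraNN => xp; rewrite mem_c xp orbT.
have [sp U_p] := andP Up.
exists (x :: p); last first.
  apply/setP=> z; rewrite !inE mem_c.
  by case: eqVneq => [->|_]; case: eqVneq => [->|_] //=; rewrite ?xA ?sA ?andbF.
split.
  rewrite /ucycle cons_uniq xp [uniq p]U_p !andbT.
  apply: (cycle_cat (s1 := [:: x]) (x := x)) => //=.
  - by move: ep; rewrite /= rcons_path => /andP[/path_sorted].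
  - by rewrite -(next_rot_cons x Uc def_c).
  - by rewrite -(prev_rot_cons x Uc def_c) // e_sym.
move=> a aA; rewrite inE; have := cA a aA; rewrite mem_c.
case: (eqVneq a s) => [-> _|_ /= ->]; first by rewrite (negPf sx) (negPf sp).
by case: eqVneq.
Qed.

(** * Degree counting in [Y] *)

Variables (Y : {set V}) (m delta : nat).
Hypothesis nbrY : forall a y, a \in A -> e a y -> y \in Y.
Hypothesis cardY : #|Y| = m.
Hypothesis deg : forall a, a \in A -> delta <= #|N a|.
Hypothesis leA_delta : #|A| <= delta.
Hypothesis le_m : m + 10 <= 4 * delta.
Hypothesis geA : 4 <= #|A|.

Lemma outer_sub_Y x c : cycle_missing x c -> outer c \subset Y.
Proof.
move=> [/andP[ec _] _]; apply/subsetP => z; rewrite inE => /andP[zc zA].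
have en := next_cycle ec zc.
by apply: (nbrY (bip_in en zA)); rewrite e_sym.
Qed.

(* The neighborhoods of [D] are disjoint outside the cycle, where only
   [m - (#|A| - 1)] vertices of [Y] are available. *)
Lemma indep_count x c (D : {set V}) : x \in A -> cycle_missing x c ->
  D \subset A -> 4 <= #|D| ->
  {in D &, forall a b, a != b -> forall y, e a y -> e b y -> y \in outer c} ->
  #|D| * #|A| + 9 <= \sum_(u in D) #|N u :&: outer c| + 3 * #|A|.
Proof.
move=> xA cx sDA D4 indD; have cardZ := card_outer_cycle xA cx.
have sZY := outer_sub_Y cx.
have : \sum_(u in D) #|N u :\: outer c| <= #|Y :\: outer c|.
  apply: sum_disjoint_le => [u uD|u v uD vD uv].
    by apply: setSD; apply/subsetP=> y; rewrite inE; apply: nbrY; apply: (subsetP sDA).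
  rewrite -setI_eq0; apply/eqP/setP=> y; rewrite !inE.
  apply/negP => /andP[/andP[yc euy] /andP[_ evy]].
  by have := indD u v uD vD uv y euy evy; rewrite inE (negPf yc).
have : \sum_(u in D) delta <= \sum_(u in D) #|N u|.
  by apply: leq_sum => u /(subsetP sDA)/deg.
rewrite sum_nat_const.
under eq_bigr => u _ do rewrite -(cardsID (outer c)).
rewrite big_split /=.
have := cardsID (outer c) Y; rewrite (setIidPr sZY) cardZ cardY.
set a := \sum_(i in D) _; set b := \sum_(i in D) _.
(* Four vertices of [D] account for [m + 10 <= 4 * delta]; the others only use [#|A| <= delta]. *)
have : #|A| * (#|D| - 4) <= delta * (#|D| - 4) by rewrite leq_mul2r leA_delta orbT.
have : delta * #|D| = delta * (#|D| - 4) + delta * 4 by nia.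
have : #|A| * #|D| = #|A| * (#|D| - 4) + #|A| * 4 by nia.
lia.
Qed.

Lemma family_indep x c (F : {set V * V}) : x \in A -> cycle_missing x c ->
  {in F, forall p, attach x c p.1 p.2} ->
  {in F &, injective fst} -> {in F &, injective snd} ->
  [/\ x |: [set next c p.2 | p in F] \subset A,
      #|x |: [set next c p.2 | p in F]| = #|F|.+1,
      x \notin [set next c p.2 | p in F] &
      {in x |: [set next c p.2 | p in F] &, forall a b, a != b ->
        forall y, e a y -> e b y -> y \in outer c}].
Proof.
move=> xA cx attF inj1 inj2; have [/andP[ec Uc] cA] := cx.
have SA p : p \in F -> (next c p.2 \in A) && (next c p.2 \in c).
  move=> /attF[pc pA _ _ _]; rewrite mem_next pc andbT.
  exact: bip_in (next_cycle ec pc) pA.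
have xS : x \notin [set next c p.2 | p in F].
  apply/imsetP => -[p /SA/andP[_ pc] xp].
  by move: (cA x xA); rewrite {1}xp pc eqxx.
split=> //.
- rewrite subUset sub1set xA; apply/subsetP=> _ /imsetP[p /SA/andP[pA _] ->] //.
- rewrite cardsU1 xS card_in_imset // => p q pF qF /(can_inj (prev_next Uc)).
  exact: inj2.
move=> a b aD bD; wlog: a b aD bD / (a != x) || (b == x).
  move=> wl ab y eay eby; case: (eqVneq a x) => [ax|anx].
    apply: (wl b a) => //; last by rewrite eq_sym.
    by apply/orP; left; rewrite -ax eq_sym.
  by apply: (wl a b) => //; rewrite anx.
case/setU1P: aD => [->|/imsetP[p pF ->]] abx ab y eay eby.
  by rewrite eqxx /= eq_sym (negPf ab) in abx.
case/setU1P: bD ab eby => [->|/imsetP[q qF ->]] ab eby.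
  by apply: (attach_indep_missing xA cx (attF p pF)).
have pq : p != q by apply: contraNneq ab => ->.
apply: (attach_indep xA cx (attF p pF) (attF q qF)) => //.
  by apply: contraNneq pq => /inj2->.
by apply: contraNneq pq => /inj1->.
Qed.

Lemma card_swappable_ends u v Q : u \in A -> v \in A -> u != v ->
  ham_path u v Q -> #|v |: (u |: swappable u v Q)| = (#|swappable u v Q|).+2.
Proof.
move=> uA vA uv hQ; have /andP[uR vR] := swappable_end uA vA hQ.
by rewrite (cardsU1 v) (cardsU1 u) uR in_setU1 negb_or eq_sym uv vR.
Qed.

(** This is [indep_count] for the two ends and the swappable vertices, at least four in all, with
    the cycle around one swappable vertex. *)
Lemma swappable_count u v Q d : u \in A -> v \in A -> u != v ->
  ham_path u v Q -> 2 <= #|swappable u v Q| ->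
  (forall x c, x \in A -> cycle_missing x c -> #|N x :&: outer c| <= d) ->
  (#|swappable u v Q| + 2) * #|A| + 9 <= #|swappable u v Q| * d +
     (#|N u :&: outer Q| + #|N v :&: outer Q|) + 3 * #|A|.
Proof.
move=> uA vA uv hQ R2 maxd; have /andP[uR vR] := swappable_end uA vA hQ.
have RA : swappable u v Q \subset A by apply/subsetP => r; rewrite inE => /andP[].
have [r rR] : exists r, r \in swappable u v Q by apply/card_gt0P; apply: leq_trans R2.
have [c [cc cA oc]] := swappable_cycle uA vA hQ rR.
have rA := subsetP RA r rR.
have := indep_count (D := v |: (u |: swappable u v Q)) rA (conj cc cA).
rewrite card_swappable_ends // oc => /(_ _ _ (swappable_indep uA vA hQ)).
rewrite !subUset !sub1set vA uA RA => /(_ isT).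
rewrite !ltnS => /(_ R2).
rewrite big_setU1 ?in_setU1 ?negb_or 1?eq_sym ?uv //= big_setU1 //=.
have : \sum_(i in swappable u v Q) #|N i :&: outer Q| <= \sum_(i in swappable u v Q) d.
  apply: leq_sum => i iR; have [c' [cc' cA' oc']] := swappable_cycle uA vA hQ iR.
  by rewrite -oc'; apply: maxd; [apply: (subsetP RA) | split].
rewrite sum_nat_const; lia.
Qed.

(* Each swappable vertex is missed by a cycle with the same outer vertices, hence
   has at most [d] neighbors there; [indep_count] then limits their number. *)
Lemma path_degree_sum u v Q d : u \in A -> v \in A -> u != v ->
  ham_path u v Q -> 4 <= d -> d < #|A| ->
  (forall x c, x \in A -> cycle_missing x c -> #|N x :&: outer c| <= d) ->
  (#|N u :&: outer Q| + #|N v :&: outer Q| - #|A|) * (#|A| - d).-1 + 9 <= 2 * #|A|.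
Proof.
move=> uA vA uv hQ d4 dA maxd; have := degree_sum_le uA vA hQ.
have [R2|] := leqP 2 #|swappable u v Q|; last by nia.
have := swappable_count uA vA uv hQ R2 maxd.
move: #|swappable _ _ _| (_ + #|N v :&: _|) R2 => r D R2 le1 le2.
have [leDA|ltAD] := leqP D #|A|; first by move: leDA; rewrite -subn_eq0 => /eqP->; lia.
have [f fE] : exists f, D = #|A| + f by exists (D - #|A|); lia.
have [g gE] : exists g, #|A| = d + g.+1 by exists (#|A| - d).-1; lia.
have -> : D - #|A| = f by lia.
have -> : (#|A| - d).-1 = g by lia.
(* By [degree_sum_le], [f <= r], so the excess [f] of the degree sum is absorbed and
   [r * g + 9 <= 2 * #|A|] remains. *)
have : f * g <= r * g by rewrite leq_mul2r; apply/orP; right; lia.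
nia.
Qed.

(** * Excluding degree at least four on a missing cycle *)

Hypothesis super_card : forall B : {set V}, B \subset A -> 3 <= #|B| ->
  #|B| <= #|[set y in Y | 2 <= #|N y :&: B|]|.

(** [indep_count] for [x], which contributes [#|T|], and the successors of its neighbors on the
    cycle; four vertices are required, whence the alternative [#|T| < 3]. *)
Lemma gap_family x c : x \in A -> cycle_missing x c ->
  let T := N x :&: outer c in
  [/\ next c @: T \subset A, #|next c @: T| = #|T| &
      #|T|.+1 * #|A| + 9 <=
        #|T| + \sum_(s in next c @: T) #|N s :&: outer c| + 3 * #|A|
      \/ #|T| < 3].
Proof.
move=> xA cx T; have [/andP[ec Uc] cA] := cx.
pose F := [set (y, y) | y in T].
have attF : {in F, forall p, attach x c p.1 p.2}.
  move=> _ /imsetP[y + ->]; rewrite !inE => /and3P[exy yc yA].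
  exact: attach_gap.
have inj1 : {in F &, injective fst} by move=> _ _ /imsetP[y _ ->] /imsetP[z _ ->] /= ->.
have inj2 : {in F &, injective snd} by move=> _ _ /imsetP[y _ ->] /imsetP[z _ ->] /= ->.
have [] := family_indep xA cx attF inj1 inj2.
have -> : [set next c p.2 | p in F] = next c @: T.
  apply/setP=> s; apply/imsetP/imsetP => [[_ /imsetP[y yT ->] ->]|[y yT ->]]; first by exists y.
  by exists (y, y) => //; apply: imset_f.
have cF : #|F| = #|T| by rewrite card_imset // => y z [].
have cS : #|next c @: T| = #|T| by rewrite card_imset //; apply: can_inj (prev_next Uc).
rewrite cF => sDA cD xS indD; split=> //.
  by apply: subset_trans sDA; apply: subsetUr.
have [T3|] := leqP 3 #|T|; [left|by right].
have := indep_count xA cx sDA _ indD; rewrite cD => /(_ T3).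
by rewrite big_setU1.
Qed.

(** With gaps attached through themselves, the path of [attach_path] has the same outer vertices as
    [c], so [path_degree_sum] transfers. *)
Lemma gap_pair_sum x c d y y' : x \in A -> cycle_missing x c ->
  4 <= d -> d < #|A| ->
  (forall x c, x \in A -> cycle_missing x c -> #|N x :&: outer c| <= d) ->
  y \in N x :&: outer c -> y' \in N x :&: outer c -> y != y' ->
  (#|N (next c y) :&: outer c| + #|N (next c y') :&: outer c| - #|A|)
    * (#|A| - d).-1 + 9 <= 2 * #|A|.
Proof.
move=> xA cx d4 dA maxd; rewrite !inE => /and3P[exy yc yA] /and3P[exy' yc' yA'] yy'.
have [/andP[ec Uc] cA] := cx.
have [Q [hQ mem_Q]] := attach_path xA cx (attach_gap cx yc yA exy)
  (attach_gap cx yc' yA' exy') yy' yy'.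
have oQ : outer Q = outer c.
  apply/setP=> z; rewrite !inE mem_Q.
  case: (eqVneq z y) => [->|_] /=; first by rewrite yc yA.
  case: (eqVneq z y') => [->|_] /=; first by rewrite yc' yA'.
  by case: (eqVneq z x) => [->|_] /=; rewrite ?xA ?andbF // !andbT.
rewrite -oQ; apply: path_degree_sum hQ d4 dA maxd.
- exact: bip_in (next_cycle ec yc) yA.
- exact: bip_in (next_cycle ec yc') yA'.
- by rewrite (can_eq (prev_next Uc)).
Qed.

Lemma prev_outer x c a : cycle_missing x c -> a \in A -> a != x ->
  prev c a \in outer c.
Proof.
move=> [/andP[ec Uc] cA] aA ax; have ac : a \in c by rewrite cA.
rewrite inE mem_prev ac /=; apply/negP => pA.
by have := prev_cycle ec ac; rewrite (not_edge pA aA).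
Qed.

Lemma next_outer x c a : cycle_missing x c -> a \in A -> a != x ->
  next c a \in outer c.
Proof.
move=> [/andP[ec Uc] cA] aA ax; have ac : a \in c by rewrite cA.
by rewrite inE mem_next ac (bip_notin (next_cycle ec ac) aA).
Qed.

Lemma super_nbr_indep_sub (B Z : {set V}) :
  {in B &, forall a b, a != b -> forall y, e a y -> e b y -> y \in Z} ->
  [set y in Y | 2 <= #|N y :&: B|] \subset Z.
Proof.
move=> indB; apply/subsetP=> y; rewrite inE => /andP[_ /card_gt1P[a [b [+ + ab]]]].
rewrite !inE => /andP[eya aB] /andP[eyb bB].
by apply: (indB a b) => //; rewrite e_sym.
Qed.

(** Otherwise [succ_indep] applies to all of [A], and the super-neighborhood of [A] would fit into
    the [#|A|.-1] outer vertices. *)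
Lemma no_full x c : x \in A -> cycle_missing x c ->
  ~~ (outer c \subset N x).
Proof.
move=> xA cx; apply/negP => /subsetP sub.
have := super_card (subxx A); rewrite (leq_trans _ geA) // => /(_ isT).
rewrite leqNgt => /negP[]; rewrite -(ltn_predK geA) ltnS.
rewrite -(card_outer_cycle xA cx); apply/subset_leq_card/super_nbr_indep_sub.
move=> a b aA bA ab y; apply: (succ_indep xA cx aA bA ab).
  by have [//|ax] := eqVneq a x; have := sub _ (prev_outer cx aA ax); rewrite inE.
by have [//|ax] := eqVneq b x; have := sub _ (prev_outer cx bA ax); rewrite inE.
Qed.

(* Comparing successors and predecessors of the gaps, two vertices with a common
   neighbor off the cycle can only be the two ends of the gap [y0]; a third
   neighbor [q] of [y0] then closes a Hamiltonian cycle. *)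
Lemma no_full_but_one x c y0 : x \in A -> cycle_missing x c ->
  y0 \in outer c -> ~~ e x y0 -> ~ {in outer c :\ y0, forall y, e x y}.
Proof.
move=> xA cx y0c nxy0 full; have [cc cA] := cx; have [ec Uc] := andP cc.
have [y0_c y0A] : y0 \in c /\ y0 \notin A by move: y0c; rewrite inE => /andP[].
pose s0 := next c y0; pose t0 := prev c y0.
have succP a : a \in A -> a != s0 -> (a == x) || e x (prev c a).
  move=> aA as0; have [//|ax] := eqVneq a x; apply: full.
  rewrite in_setD1 (prev_outer cx aA ax) andbT.
  by rewrite -(can_eq (prev_next Uc)) (next_prev Uc).
have predP a : a \in A -> a != t0 -> (a == x) || e x (next c a).
  move=> aA at0; have [//|ax] := eqVneq a x; apply: full.
  rewrite in_setD1 (next_outer cx aA ax) andbT.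
  by rewrite -(can_eq (next_prev Uc)) (prev_next Uc).
have [z zS zc] : exists2 z, z \in [set y in Y | 2 <= #|N y :&: A|] & z \notin outer c.
  apply/subsetPn; apply/negP => /subset_leq_card.
  rewrite (card_outer_cycle xA cx) leqNgt => /negP[].
  have := super_card (subxx A); rewrite (leq_trans _ geA) // => /(_ isT).
  by rewrite -[X in X <= _](ltn_predK geA).
have [i [p [[def_c pn ep] [def_s def_t y0p Up mem_c]]]] := rot_outer x cc y0_c y0A.
have [ezs ezt] : e z s0 /\ e z t0.
  move: zS; rewrite inE => /andP[_ /card_gt1P[a [b [+ + ab]]]].
  rewrite !inE => /andP[eza aA] /andP[ezb bA].
  have /orP st : (a == s0) || (b == s0).
    apply: contraR zc; rewrite negb_or => /andP[as0 bs0].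
    by apply: (succ_indep xA cx aA bA ab); rewrite ?succP // e_sym.
  have /orP tt : (a == t0) || (b == t0).
    apply: contraR zc; rewrite negb_or => /andP[as0 bs0].
    by apply: (pred_indep xA cx aA bA ab); rewrite ?predP // e_sym.
  by case: st tt => /eqP<- [] /eqP<-.
have s0A : s0 \in A by apply: bip_in y0A; apply: next_cycle.
have t0A : t0 \in A by apply: bip_in y0A; rewrite e_sym; apply: prev_cycle.
(* The super-neighborhood of [A :\ s0] lies in [outer c] and is at least as large, so it contains
   [y0], which thus has two neighbors in [A :\ s0]. *)
have [q [qA qs qt ey0q]] : exists q, [/\ q \in A, q != s0, q != t0 & e y0 q].
  have sub : [set y in Y | 2 <= #|N y :&: (A :\ s0)|] \subset outer c.
    apply: super_nbr_indep_sub => a b; rewrite !in_setD1.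
    move=> /andP[as0 aA] /andP[bs0 bA] ab y.
    by apply: (succ_indep xA cx aA bA ab); rewrite ?succP.
  have cA1 : #|A :\ s0| = #|A|.-1 by rewrite (cardsD1 s0 A) s0A.
  have le3 : 3 <= #|A :\ s0| by rewrite cA1; case: #|A| geA.
  have := super_card (subsetDl A [set s0]) le3.
  rewrite cA1 -(card_outer_cycle xA cx) => le_c.
  have /eqP E : [set y in Y | 2 <= #|N y :&: (A :\ s0)|] == outer c.
    by rewrite eqEcard sub le_c.
  move: y0c; rewrite -E inE => /andP[_ /card_gt1P[a [b [+ + ab]]]].
  rewrite !inE => /and3P[eya as0 aA] /and3P[eyb bs0 bA].
  have [at0|at0] := eqVneq a t0; last by exists a.
  by exists b; split=> //; rewrite -at0 eq_sym.
have qx : q != x by apply: contraNneq nxy0 => <-; rewrite e_sym.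
have qp : q \in p.
  have := cA q qA; rewrite mem_c qx; case: eqVneq => //= qy.
  by rewrite qy (negPf y0A) in qA.
case/splitPr: qp def_c pn ep def_s def_t y0p Up mem_c => p1 p2 def_c _ ep.
rewrite -/s0 -/t0 => def_s def_t y0p Up mem_c.
have p1n : p1 != [::] by apply: contraNneq qs => p10; rewrite def_s p10.
have p2n : p2 != [::] by apply: contraNneq qt => p20; rewrite def_t p20 last_cat.
case/lastP: p2 p2n def_c ep def_s def_t y0p Up mem_c => // p2 t _ def_c ep def_s.
rewrite last_cat last_cons last_rcons => def_t; rewrite -{}def_t in def_c ep *.
move=> y0p Up mem_c.
have p2n : p2 != [::].
  apply: contraTneq ep => ->; rewrite sorted_cat_cons /=.
  by rewrite (not_edge qA t0A) andbF.
have t0s0 : t0 != s0.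
  have : s0 \in p1 by rewrite def_s; case: (p1) p1n => // a s _; apply: mem_head.
  apply: contraTneq => <-; move: Up; rewrite cat_uniq => /and3P[_ /hasPn/(_ t0) + _].
  by apply; rewrite inE mem_rcons mem_head orbT.
have t0x : t0 != x.
  by rewrite -cA // mem_prev.
have exq : e x (last x p1).
  have -> : last x p1 = prev c q.
    rewrite (prev_rot_cat x Uc (i := i) (p1 := y0 :: p1) (y := q) (p2 := rcons p2 t0)) //.
    by case: (p1) p1n.
  by have := succP q qA qs; rewrite (negPf qx).
have ext : e x (last x p2).
  have := succP t0 t0A t0s0; rewrite (negPf t0x) /=.
  rewrite (prev_rot_cat x Uc (i := i) (p1 := y0 :: p1 ++ q :: p2) (y := t0) (p2 := [::])) //.
    by rewrite /= last_cat /=; case: (p2) p2n.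
  by rewrite def_c cats1 /= rcons_cat.
have zA : z \notin A by apply: bip_notin s0A; rewrite e_sym.
have xc : x \notin c by rewrite cA // eqxx.
have zNc : z \notin c by move: zc; rewrite inE zA andbT.
have zx : z != x by apply: contraNneq zA => ->.
have [e1 e2] := cat_sorted2 ep.
have [e3 _] : sorted e (q :: p2) * sorted e [:: t0].
  by apply: cat_sorted2; rewrite cats1.
(* The cycle [c] reads [y0], [p1], [q], [p2], [t0]; the new one reaches [y0] from [z] through [t0],
   and returns to [z] through [x] and [p1] reversed. *)
apply: (noham (c := [:: z, t0, y0, q & p2] ++ x :: rev p1)); last first.
  move=> a aA; rewrite !(mem_cat, inE) mem_rev; have := cA a aA.
  rewrite mem_c mem_cat inE mem_rcons inE.
  case: (a == x) => [_|/= /esym]; first by rewrite !orbT.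
  by case: (a \in p1); case: (a == t0); case: (a == y0); case: (a == q); case: (a \in p2);
    rewrite //= ?orbT.
apply/andP; split.
  apply: (cycle_cat (x := x)) => //=.
  - by rewrite ezt ey0q -[path e q p2]/(sorted e (q :: p2)) e3 andbT prev_cycle.
  - rewrite -[path _ _ _]/(sorted e ([:: x] ++ rev p1)).
    by apply: (sorted_cat (x := x)); rewrite ?rev_sorted_sym ?head_rev.
  - by rewrite e_sym; case: (p2) p2n ext.
  - rewrite last_rev; have <- : s0 = head x p1 by rewrite def_s; case: (p1) p1n.
    by rewrite e_sym.
have Uq : uniq (x :: z :: y0 :: p1 ++ q :: rcons p2 t0).
  rewrite 2!cons_uniq -def_c rot_uniq Uc in_cons !mem_rot (negPf xc) (negPf zNc).
  by rewrite orbF [x == z]eq_sym zx.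
rewrite -(perm_uniq (s1 := x :: z :: y0 :: p1 ++ q :: rcons p2 t0)) //.
apply/permP => P; rewrite /= !count_cat /= count_rev -cats1 count_cat /=.
move: (count P p1) (count P p2) (P x : nat) (P z : nat) (P y0 : nat) (P q : nat) (P t0 : nat).
by clear; lia.
Qed.

(* Let [k = #|A| - d].  For [k = 1, 2] use the super-neighborhood condition; for
   [k >= 4] average [gap_pair_sum] over pairs of successors; for [k = 3] all but
   two successors can be exchanged with [x], hence have degree at most [d]. *)
Lemma no_large_degree d : 4 <= d ->
  (forall x c, x \in A -> cycle_missing x c -> #|N x :&: outer c| <= d) ->
  forall x c, x \in A -> cycle_missing x c -> #|N x :&: outer c| <> d.
Proof.
move=> d4 maxd x c xA cx dT; have cZ := card_outer_cycle xA cx.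
pose T := N x :&: outer c; have [/andP[ec Uc] cA] := cx.
have TP y : (y \in T) = e x y && (y \in outer c) by rewrite !inE.
have cD := cardsD (outer c) (N x); rewrite setIC dT cZ in cD.
have led : d <= #|A|.-1 by rewrite -dT -cZ subset_leq_card // subsetIr.
have dA : d < #|A| by lia.
have [SA cS [sumS|]] := gap_family xA cx; last by rewrite dT; lia.
rewrite -/T dT in SA cS sumS.
set S := next c @: T in SA cS sumS.
have pairS : {in S &, forall s s', s != s' ->
    (#|N s :&: outer c| + #|N s' :&: outer c| - #|A|) * (#|A| - d).-1 + 9 <= 2 * #|A|}.
  move=> _ _ /imsetP[y yT ->] /imsetP[y' yT' ->] ss'.
  apply: (gap_pair_sum xA cx) => //; first by apply: contraNneq ss' => ->.
have [e4|e3] := leqP 4 (#|A| - d).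
  (* Weighting the degrees by this factor turns [pairS] into a linear bound on pairs, as
     [sum_pairs_le] requires. *)
  pose k := (#|A| - d).-1.
  have := sum_pairs_le (D := S) (g := fun s => k * #|N s :&: outer c|)
    (B := k * #|A| + 2 * #|A| - 9).
  rewrite cS => /(_ (ltn_trans _ d4)) => /(_ isT).
  rewrite -big_distrr /=; move: sumS; set Sig := \sum_(s in S) _ => sumS le_pairs.
  have {le_pairs} := le_pairs _; have /[swap]/[apply] : {in S &, forall s s', s != s' ->
     k * #|N s :&: outer c| + k * #|N s' :&: outer c| <= k * #|A| + 2 * #|A| - 9}.
    move=> s s' sS sS' ss'; have := pairS s s' sS sS' ss'; rewrite -/k.
    move: (#|N s :&: _|) (#|N s' :&: _|) => a b; nia.
  have [p dE] : exists p, d = 4 + p by exists (d - 4); lia.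
  have [q nE] : exists q, #|A| = d + (4 + q) by exists (#|A| - d - 4); lia.
  have -> : k = 3 + q by rewrite /k; lia.
  rewrite nE dE in sumS *; nia.
have [e2|] := leqP (#|A| - d) 2.
  have [e1|e1] : #|A| - d = 1 \/ #|A| - d = 2 by lia.
    have /negP[] := no_full xA cx.
    by rewrite -setD_eq0 -cards_eq0 cD; apply/eqP; lia.
  have /cards1P[y0 Dy0] : #|outer c :\: N x| == 1 by rewrite cD; apply/eqP; lia.
  have : y0 \in outer c :\: N x by rewrite Dy0 set11.
  rewrite in_setD inE => /andP[nxy0 y0c].
  apply: (no_full_but_one xA cx y0c nxy0) => y; rewrite in_setD1 => /andP[yy0 yc].
  by apply: contraNT yy0 => nxy; rewrite -in_set1 -Dy0 in_setD inE nxy yc.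
move=> e3'; have {e3 e3'} e3 : #|A| = d + 3 by lia.
(* Vertices of [S1] have both cycle neighbors adjacent to [x]. Each vertex of [S0] precedes one of
   the two outer vertices not adjacent to [x]. *)
pose S1 := [set s in S | e x (next c s)]; pose S0 := S :\: S1.
have Sx s : s \in S -> [/\ s \in A, s != x & e x (prev c s)].
  case/imsetP=> y; rewrite TP => /andP[exy]; rewrite inE => /andP[yc yA] ->.
  have nA : next c y \in A by apply: (bip_in _ yA); apply: next_cycle.
  by split=> //; [rewrite -cA // mem_next | rewrite prev_next].
have le1 : \sum_(s in S1) #|N s :&: outer c| <= #|S1| * d.
  rewrite -sum_nat_const; apply: leq_sum => s; rewrite inE => /andP[/Sx[sA sx exp] exn].
  have [c' cs <-] := exchange_missing xA cx sA sx exp exn.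
  exact: maxd.
have cS0 : #|S0| <= 2.
  have <- : #|outer c :\: N x| = 2 by rewrite cD; lia.
  rewrite -(card_imset _ (can_inj (prev_next Uc))); apply/subset_leq_card/subsetP.
  move=> _ /imsetP[s + ->]; rewrite !inE => /andP[+ sS]; rewrite sS /= => ->.
  have [sA sx _] := Sx s sS; have := next_outer cx sA sx; by rewrite inE.
have cS01 : #|S1| + #|S0| = d.
  by rewrite -cS -(cardsID S1 S) (setIidPr _) //; apply/subsetP=> s; rewrite inE => /andP[].
have sumE : \sum_(s in S) #|N s :&: outer c| =
    \sum_(s in S1) #|N s :&: outer c| + \sum_(s in S0) #|N s :&: outer c|.
  rewrite (big_setID S1) /=; congr (_ + _); apply: eq_bigl => s.
  by rewrite !inE andbA andbb.
have maxZ s : #|N s :&: outer c| <= #|A|.-1 by rewrite -cZ subset_leq_card // subsetIr.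
(* For two vertices in [S0] the bound [#|A|.-1] on each is too weak, and [pairS] is used; for one or
   none it suffices. *)
have [S02|S01] := eqVneq #|S0| 2.
  have [s [s' [ss' S0E]]] : exists s s', s != s' /\ S0 = [set s; s'].
    have /cards2P[s [s' [ss' ->]]] : #|S0| == 2 by rewrite S02.
    by exists s, s'.
  have [sS sS'] : s \in S /\ s' \in S.
    by split; apply: (subsetP (subsetDl S S1)); rewrite -/S0 S0E !inE eqxx ?orbT.
  have := pairS s s' sS sS' ss'; move: sumS; rewrite sumE S0E big_setU1 ?inE //= big_set1.
  move: (#|N s :&: _|) (#|N s' :&: _|) le1 => a b le1; rewrite e3.
  have -> : (d + 3 - d).-1 = 2 by lia.
  rewrite S02 in cS01; have {cS01} cS01 : #|S1| = d - 2 by lia.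
  rewrite cS01 in le1; move: le1; set Sig := \sum_(s in S1) _ => le1.
  have [p dE] : exists p, d = 4 + p by exists (d - 4); lia.
  rewrite dE in le1 *; nia.
have : \sum_(s in S0) #|N s :&: outer c| <= #|S0| * #|A|.-1.
  by rewrite -sum_nat_const; apply: leq_sum.
move: sumS le1; rewrite sumE; set Sig := \sum_(s in S1) _; set Sig0 := \sum_(s in S0) _.
have [|S00] : #|S0| = 1 \/ #|S0| = 0 by lia.
  move=> E; rewrite E; have -> : #|S1| = d - 1 by lia.
  have [p dE] : exists p, d = 4 + p by exists (d - 4); lia.
  rewrite e3 dE; nia.
rewrite S00; have -> : #|S1| = d by lia.
rewrite e3; nia.
Qed.

(** * Cycles of maximal degree and the confinement of common neighbors *)

Hypothesis common_nbr : forall x u, x \in A -> u \in A -> x != u ->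
  exists y, e x y && e u y.
Hypothesis two_nbrs : forall x u v, x \in A -> u \in A -> v \in A ->
  x != u -> x != v -> u != v -> 1 < #|N x :&: (N u :|: N v)|.
Hypothesis ex_cycle_missing : forall x, x \in A -> exists c, cycle_missing x c.

(** Descent from the trivial bound: [no_large_degree] excludes each maximum above three in turn. *)
Lemma degree_le3 x c : x \in A -> cycle_missing x c -> #|N x :&: outer c| <= 3.
Proof.
suff le3 j : (forall x c, x \in A -> cycle_missing x c -> #|N x :&: outer c| <= 3 + j) ->
    forall x c, x \in A -> cycle_missing x c -> #|N x :&: outer c| <= 3.
  apply: (le3 #|V|) => {}x {}c _ _; apply: leq_trans (max_card _) (leq_addl _ _).
elim: j => [|j IHj] le_j; first by move: le_j; rewrite addn0.
apply: IHj => {}x {}c xA cx; have := le_j x c xA cx.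
rewrite addnS leq_eqVlt ltnS => /orP[/eqP E|//].
by have := @no_large_degree (3 + j).+1 isT; rewrite -addnS => /(_ le_j x c xA cx); case.
Qed.

(** For [d = 3] and [4 <= #|A|], two swappable vertices would make [swappable_count] contradict
    [degree_sum_le]. *)
Lemma path_degree_sum_low u v Q : u \in A -> v \in A -> u != v ->
  ham_path u v Q -> #|N u :&: outer Q| + #|N v :&: outer Q| <= #|A|.+1.
Proof.
move=> uA vA uv hQ; have := degree_sum_le uA vA hQ.
have [R2|] := leqP 2 #|swappable u v Q|; last by lia.
have := swappable_count uA vA uv hQ R2 degree_le3; nia.
Qed.

(** The path of [attach_path] loses [y] when [w != y], and [y'] likewise. Each end loses at most its
    own gap: the other gap, if adjacent to it, would be a common neighbor of both ends off the
    path. *)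
Lemma attach_pair_sum x c w y w' y' : x \in A -> cycle_missing x c ->
  attach x c w y -> attach x c w' y' -> y != y' -> w != w' ->
  #|N (next c y) :&: outer c| + #|N (next c y') :&: outer c| <=
    #|A|.+1 + ((w != y) + (w' != y')).
Proof.
move=> xA cx aw aw' yy' ww'; have [Q [hQ mem_Q]] := attach_path xA cx aw aw' yy' ww'.
have [[yc yA _ _ _] [yc' yA' _ _ _]] := (aw, aw').
have [/andP[ec Uc] cA] := cx.
have [eny eny'] := (next_cycle ec yc, next_cycle ec yc').
have [nA nA'] := (bip_in eny yA, bip_in eny' yA').
have nn : next c y != next c y' by rewrite (can_eq (prev_next Uc)).
have low := path_degree_sum_low nA nA' nn hQ.
have half s v w0 : (forall z, z \in c -> e s z -> z \notin Q -> z = v /\ w0 != v) ->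
    #|N s :&: outer c| <= #|N s :&: outer Q| + (w0 != v).
  move=> lost; have <- : #|[set z in [set v] | w0 != v]| = (w0 != v).
    case: (w0 != v).
      by rewrite -[nat_of_bool _](cards1 v); apply: eq_card => z; rewrite !inE andbT.
    by apply/eqP; rewrite cards_eq0; apply/eqP/setP=> z; rewrite !inE andbF.
  apply: leq_trans (leq_card_setU _ _).1; apply/subset_leq_card/subsetP=> z.
  rewrite !inE => /and3P[esz zc zA]; rewrite esz zA andbT /=.
  by case: (boolP (z \in Q)) => //= /(lost z zc esz)[-> ->]; rewrite eqxx.
have le1 := half (next c y) y w; have le2 := half (next c y') y' w'.
apply: leq_trans (leq_add (le1 _) (le2 _)) _; last by move: low; clear; lia.
  move=> z zc esz zQ; move: (zQ); rewrite mem_Q zc.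
  case: (eqVneq z y) => [-> /norP[] | _]; first by rewrite eq_sym.
  case: (eqVneq z y') => [zy|_] /=; last by rewrite !orbT.
  by case/negP: zQ; apply: (ham_path_close nA hQ esz); rewrite zy e_sym.
move=> z zc esz zQ; move: (zQ); rewrite mem_Q zc.
case: (eqVneq z y') => [-> /norP[_ /norP[]] | _]; first by rewrite eq_sym.
case: (eqVneq z y) => [zy|_] /=; last by rewrite !orbT.
by case/negP: zQ; apply: (ham_path_close nA hQ _ esz); rewrite zy e_sym.
Qed.

Lemma best_cycle x : x \in A -> exists2 c, cycle_missing x c &
  forall c', cycle_missing x c' -> #|N x :&: outer c'| <= #|N x :&: outer c|.
Proof.
move=> xA; have [c0 cx0] := ex_cycle_missing xA.
pose B c := cycle e c && [forall a in A, (a \in c) == (a != x)].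
have BP c : reflect (cycle_missing x c) (uniq c && B c).
  apply: (iffP and3P) => [[Uc ec /forall_inP cA]|[/andP[ec Uc] cA]]; last first.
    by split=> //; apply/forall_inP => a aA; rewrite cA.
  by split; [rewrite /ucycle ec Uc | move=> a aA; apply/eqP/cA].
pose D k t := B t && (#|N x :&: outer t| == k).
pose P k := [exists j : 'I_#|V|.+1, [exists t : j.-tuple V, uniq t && D k t]].
have PP k : reflect (exists2 c, uniq c & D k c) (P k) := uniq_exP (D k).
have exP : exists k, P k.
  exists #|N x :&: outer c0|; apply/PP; have /BP/andP[Uc Bc] := cx0.
  by exists c0; rewrite // /D Bc eqxx.
have ubP k : P k -> k <= #|V|.
  by move/PP => [c _ /andP[_ /eqP<-]]; apply: max_card.
have [k /PP[c Uc /andP[Bc /eqP ck]] maxk] := ex_maxnP exP ubP.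
exists c; first by apply/BP; rewrite Uc.
move=> c' /BP/andP[Uc' Bc']; rewrite ck; apply: maxk; apply/PP.
by exists c'; rewrite // /D Bc' eqxx.
Qed.

Section BestCycle.
Variables (x : V) (c : seq V).
Hypothesis xA : x \in A.
Hypothesis cx : cycle_missing x c.
Hypothesis maxc : forall c', cycle_missing x c' ->
  #|N x :&: outer c'| <= #|N x :&: outer c|.

(** Otherwise [x] could be inserted between [a] and [next c a], through [w]. *)
Lemma offcycle_gap w a : w \notin c -> e x w -> a \in A -> a != x -> e a w ->
  ~~ e x (next c a).
Proof.
move=> wc exw aA ax eaw; apply/negP => exn; have [/andP[ec Uc] cA] := cx.
have ac : a \in c by rewrite cA.
have nc : next c a \in c by rewrite mem_next.
have := insert_vertex (y := next c a) (w := w) (b := next c a) xA cx nc.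
move=> /(_ (bip_notin (next_cycle ec ac) aA) exw); rewrite prev_next // => /(_ eaw).
rewrite wc orbT eqxx => /(_ isT exn) H; move: wc; rewrite -H ?nc //.
by rewrite e_sym next_cycle.
Qed.

(* Otherwise [w] could replace the gap after [a], and [x] would be adjacent to
   one more vertex of the new cycle. *)
Lemma offcycle_next w a : w \notin c -> e x w -> a \in A -> a != x -> e a w ->
  ~~ e (next c (next c a)) w.
Proof.
move=> wc exw aA ax eaw; apply/negP => enw; have [/andP[ec Uc] cA] := cx.
have nxy := offcycle_gap wc exw aA ax eaw.
set y := next c a in nxy enw.
have ac : a \in c by rewrite cA.
have yc : y \in c by rewrite mem_next.
have yA : y \notin A := bip_notin (next_cycle ec ac) aA.
have wA := bip_notin exw xA.
have [i [p [[def_c pn ep] [def_n def_p yp Up mem_c]]]] := rot_outer x cx.1 yc yA.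
have wp : w \notin p by move: wc; rewrite mem_c => /norP[].
have wy : w != y by apply: contraNneq wc => ->.
have cx' : cycle_missing x (w :: p).
  split.
    rewrite /ucycle cons_uniq wp [uniq p]Up !andbT.
    apply: (cycle_cat (s1 := [:: w]) (x := x)) => //=; first by rewrite -def_n e_sym.
    by rewrite -def_p prev_next.
  move=> b bA; have := cA b bA; rewrite mem_c inE.
  have -> : b == w = false by apply: contraNF wA => /eqP<-.
  by have -> : b == y = false by apply: contraNF yA => /eqP<-.
have := maxc cx'; rewrite leqNgt => /negP[].
have -> : N x :&: outer (w :: p) = w |: (N x :&: outer c).
  apply/setP=> z; rewrite !inE mem_c.
  case: (eqVneq z w) => [->|_] /=; first by rewrite exw wA.
  by case: (eqVneq z y) => [->|_] //=; rewrite (negPf nxy).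
by rewrite cardsU1 !inE (negPf wc) /= andbF.
Qed.

(* The matching [M] and the neighbors of [x] on the cycle together yield a family
   of attachments; averaging [attach_pair_sum] contradicts [indep_count]. *)
Lemma attach_bound (M : {set V * V}) :
  {in M, forall p, [/\ p.1 \notin c, e x p.1, p.2 \in A, p.2 != x & e p.2 p.1]} ->
  {in M &, injective fst} -> {in M &, injective snd} ->
  #|N x :&: outer c| + #|M| <= 3 /\
  (#|A| <= 8 -> #|N x :&: outer c| + #|M| <= 2).
Proof.
move=> MP inj1 inj2; have [/andP[ec Uc] cA] := cx.
pose T := N x :&: outer c.
have TP y : (y \in T) = e x y && (y \in outer c) by rewrite !inE.
(* Cycle neighbors of [x] attach through themselves; a matching edge from [w] to [a] attaches
   through [w] at the gap after [a], which is not adjacent to [x]. *)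
pose F1 := [set (y, y) | y in T]; pose F2 := [set (p.1, next c p.2) | p in M].
have F1P q : q \in F1 -> [/\ q.1 = q.2, q.1 \in T & q.1 \in c].
  by case/imsetP=> y yT ->; split=> //; move: yT; rewrite !inE => /and3P[].
have F2P q : q \in F2 -> [/\ q.1 \notin c, ~~ e x q.2 & attach x c q.1 q.2].
  case/imsetP=> p /MP[pc exp pA px epp] ->; have p2c : p.2 \in c by rewrite cA.
  split=> //=; first exact: offcycle_gap pc exp pA px epp.
  split=> //=; rewrite ?mem_next ?prev_next //.
    exact: bip_notin (next_cycle ec p2c) pA.
  by rewrite pc (offcycle_next pc exp pA px epp) orbT.
pose F := F1 :|: F2.
have attF : {in F, forall p, attach x c p.1 p.2}.
  move=> p /setUP[/F1P[<-]|/F2P[]//].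
  by rewrite !inE => /and3P[exp _ pA] pc; apply: attach_gap.
have cF1 : #|F1| = #|T| by rewrite card_imset // => y z [].
have cF2 : #|F2| = #|M| by rewrite card_in_imset // => p q pM qM [] /inj1->.
have F12 : [disjoint F1 & F2].
  rewrite -setI_eq0; apply/eqP/setP=> p; rewrite in_setI inE.
  by apply/negP => /andP[/F1P[_ _ pc] /F2P[]]; rewrite pc.
have cF : #|F| = #|T| + #|M|.
  by rewrite cardsU disjoint_setI0 // cards0 subn0 cF1 cF2.
have Finj1 : {in F &, injective fst}.
  move=> [w y] [w' y'] /setUP[pF|pF] /setUP[qF|qF] /= ww'.
  - have [/= <- _ _] := F1P _ pF; have [/= <- _ _] := F1P _ qF; by rewrite ww'.
  - by have [/= _ _ pc] := F1P _ pF; have [/= + _ _] := F2P _ qF; rewrite -ww' pc.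
  - by have [/= _ _ pc] := F1P _ qF; have [/= + _ _] := F2P _ pF; rewrite ww' pc.
  - case/imsetP: pF => p pM [-> ->] in ww' *; case/imsetP: qF => q qM [-> ->] in ww' *.
    by rewrite (inj1 p q).
have Finj2 : {in F &, injective snd}.
  move=> [w y] [w' y'] /setUP[pF|pF] /setUP[qF|qF] /= ww'.
  - have [/= -> _ _] := F1P _ pF; have [/= -> _ _] := F1P _ qF; by rewrite ww'.
  - have [/= <- + _] := F1P _ pF; rewrite TP; have [/= _ + _] := F2P _ qF.
    by have [/= -> _ _] := F1P _ pF; rewrite ww' => /negPf->.
  - have [/= <- + _] := F1P _ qF; rewrite TP; have [/= _ + _] := F2P _ pF.
    by have [/= -> _ _] := F1P _ qF; rewrite ww' => /negPf->.
  - case/imsetP: pF => p pM [-> ->] in ww' *; case/imsetP: qF => q qM [-> ->] in ww' *.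
    by rewrite (inj2 p q) //; apply: (can_inj (prev_next Uc)).
rewrite -cF; suff [le3 le2] : ~~ (3 < #|F|) /\ ~~ ((#|A| <= 8) && (2 < #|F|)).
  by split; [rewrite leqNgt | move=> A8; move: le2; rewrite A8 /= -leqNgt].
suff big_n : 2 < #|F| -> #|F| = 3 /\ 8 < #|A|.
  split; first by apply/negP => F4; have [E _] := big_n (ltnW F4); rewrite E in F4.
  by apply/negP => /andP[A8 /big_n[_]]; rewrite ltnNge A8.
move=> F3.
have cZ := card_outer_cycle xA cx.
have [sDA cD xS indD] := family_indep xA cx attF Finj1 Finj2.
have := indep_count xA cx sDA _ indD; rewrite cD => /(_ F3).
rewrite big_setU1 //= big_imset /=; last first.
  by move=> p q pF qF /(can_inj (prev_next Uc)); apply: Finj2.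
pose h (p : V * V) := #|N (next c p.2) :&: outer c|.
pose k (p : V * V) : nat := p.1 != p.2.
have h_le p : h p <= #|A|.-1 by rewrite -cZ subset_leq_card // subsetIr.
(* Subtracting [k] makes the pair bound uniform. The correction totals at most [#|M|], as only [F2]
   contributes. *)
have := sum_pairs_le (D := F) (g := fun p => h p - k p) (B := #|A|.+1) (ltnW F3).
have /[swap]/[apply] : {in F &, forall p q, p != q -> (h p - k p) + (h q - k q) <= #|A|.+1}.
  move=> p q pF qF pq.
  have := attach_pair_sum xA cx (attF p pF) (attF q qF).
  rewrite -/(h p) -/(h q) -/(k p) -/(k q).
  have -> : p.2 != q.2 by apply: contraNneq pq => /Finj2->.
  have -> : p.1 != q.1 by apply: contraNneq pq => /Finj1->.
  by move=> /(_ isT isT); move: (h_le p) (h_le q); clear; lia.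
have : \sum_(p in F) h p <= \sum_(p in F) (h p - k p) + \sum_(p in F) k p.
  by rewrite -big_split /=; apply: leq_sum => p _; clear; lia.
have : \sum_(p in F) k p <= #|M|.
  rewrite -cF2 -sum1_card (bigID (mem F2)) /= [X in _ + X]big1 => [|p]; last first.
    by case/andP=> /setUP[/F1P[p12 _ _] _|->//]; rewrite /k p12 eqxx.
  rewrite addn0 (eq_bigl (mem F2)) => [|p]; last by rewrite /= in_setU; case: (p \in F2); rewrite ?orbT ?andbF.
  by apply: leq_sum => p _; rewrite /k; case: (_ != _).
rewrite -/T; rewrite cF in F3 *.
move: (\sum_(p in F) k p) (\sum_(p in F) h p) (\sum_(p in F) (h p - k p)) => sk sh sg.
move: #|T| #|M| F3 => t l F3; set a := #|A|; have a4 : 4 <= a := geA.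
have [j tl] : exists j, t + l = 3 + j by exists (t + l - 3); move: F3; clear; lia.
rewrite tl => h1 h2 h3 h4.
(* For [j = 0] this gives [9 <= a]; for [j > 0] it contradicts [4 <= a]. *)
have {h1 h2 h3 h4} : j * a + 9 <= a + 3 * j by move: tl h1 h2 h3 h4; clear; nia.
by move: a4; clear; case: j => [|j]; nia.
Qed.

End BestCycle.

(** [E] joins the off-cycle neighbors of [x] to the other vertices of [A]. A cover [L], [R] smaller
    than [k] yields [T :|: L] and [R]; otherwise [konig] gives a matching too large for
    [attach_bound]. *)
Lemma common_nbrs_confined x : x \in A -> exists K I : {set V},
  [/\ #|K| + #|I| <= 3, #|A| <= 8 -> #|K| + #|I| <= 2 &
      forall u, u \in A -> u != x -> u \notin I -> N x :&: N u \subset K].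
Proof.
move=> xA; have [c cx maxc] := best_cycle xA; have [_ cA] := cx.
pose T := N x :&: outer c; pose k := (if #|A| <= 8 then 3 else 4) - #|T|.
pose E := [set p : V * V | [&& p.1 \notin c, e x p.1, p.2 \in A, p.2 != x & e p.2 p.1]].
have d3 := degree_le3 xA cx.
have [/existsP[L /existsP[R /andP[cLR ltk]]]|no_cover] := boolP
    [exists L : {set V}, [exists R : {set V}, is_cover E L R && (#|L| + #|R| < k)]].
  have TL := (leq_card_setU T L).1.
  exists (T :|: L), R; split.
  - by move: ltk; rewrite /k; case: ifP => _; lia.
  - by move=> A8; move: ltk; rewrite /k A8; lia.
  move=> u uA ux uR; apply/subsetP=> y; rewrite !inE => /andP[exy euy].
  rewrite exy (bip_notin exy xA) andbT /=; case: (boolP (y \in c)) => //= yc.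
  have /= := forall_inP cLR (y, u); rewrite inE /= yc exy uA ux euy => /(_ isT).
  by rewrite (negPf uR) orbF.
have [L R cLR|M [sME kM inj1 inj2]] := konig (E := E) (k := k).
  rewrite leqNgt; apply/negP => lt; move/existsP: no_cover; apply.
  by exists L; apply/existsP; exists R; rewrite cLR.
have [] := attach_bound xA cx maxc _ inj1 inj2.
  by move=> p /(subsetP sME); rewrite inE => /and5P[].
by rewrite -/T; move: kM; rewrite /k; case: (leqP #|A| 8) => _ kM le3 le2; [have := le2 isT | ]; lia.
Qed.

(** One vertex outside [I] forces [K] to be nonempty, and two force two elements, which leaves
    little room for [I]. *)
Lemma common_nbrs_confined_strong x : x \in A -> exists K I : {set V},
  [/\ #|K| <= 3, #|I| <= 1, #|A| <= 8 -> #|I| = 0 &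
      forall u, u \in A -> u != x -> u \notin I -> N x :&: N u \subset K].
Proof.
move=> xA; have [K [I [le3 le2 sK]]] := common_nbrs_confined xA; exists K, I.
pose B := A :\ x :\: I.
have BP u : u \in B -> [/\ u \in A, u != x & u \notin I].
  by rewrite !inE => /and3P[-> -> ->].
have cB : #|A| <= #|B| + #|I|.+1.
  have := cardsID I (A :\ x); rewrite (cardsD1 x A) xA -/B.
  have := subset_leq_card (subsetIr (A :\ x) I); lia.
have K1 : 0 < #|B| -> 0 < #|K|.
  case/card_gt0P=> u /BP[uA ux uI]; apply/card_gt0P.
  have xu : x != u by rewrite eq_sym.
  have [y /andP[exy euy]] := common_nbr xA uA xu; exists y.
  by apply: (subsetP (sK u uA ux uI)); rewrite !inE exy.
have K2 : 1 < #|B| -> 1 < #|K|.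
  case/card_gt1P=> u [v [/BP[uA ux uI] /BP[vA vx vI] uv]].
  apply: leq_trans (two_nbrs xA uA vA _ _ uv) _; rewrite 1?eq_sym //.
  by apply: subset_leq_card; rewrite setIUr subUset !sK.
have leI : #|A| <= 8 -> #|I| = 0 by move=> /[dup] A8 /le2; lia.
split=> //; first by lia.
by have [/leI->//|A9] := leqP #|A| 8; lia.
Qed.

(* Four vertices, each sharing at most three neighbors with the union of the
   neighborhoods of those chosen later, need [4 * delta - 9] vertices in [Y]. *)
Lemma no_critical_bigraph : False.
Proof.
have pick (B : {set V}) : #|B| < #|A| -> exists2 u, u \in A & u \notin B.
  move=> ltBA; apply/subsetPn; apply/negP => /subset_leq_card; lia.
have c1 (u : V) (B : {set V}) : #|u |: B| <= #|B|.+1.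
  by rewrite cardsU1; case: (_ \notin _).
have cU (B C : {set V}) : #|B :|: C| <= #|B| + #|C| := (leq_card_setU B C).1.
(* Exceptions occur only for [8 < #|A|], so three chosen vertices and their exceptions never exhaust
   [A]. *)
have small (I : {set V}) : #|I| <= 1 -> (#|A| <= 8 -> #|I| = 0) ->
    #|I| = 0 \/ #|I| = 1 /\ 8 < #|A|.
  by case: (leqP #|A| 8) => [_ _ /(_ isT)|]; [left | clear; lia].
have [|u4 u4A _] := pick set0; first by rewrite cards0; apply: leq_trans geA.
have [K4 [I4 [k4 /small i4 /i4{}i4 s4]]] := common_nbrs_confined_strong u4A.
have [|u3 u3A] := pick (u4 |: I4).
  by move: (c1 u4 I4) i4 geA; clear; lia.
rewrite !inE !negb_or => /andP[u34 u3I4].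
have [K3 [I3 [k3 /small i3 /i3{}i3 s3]]] := common_nbrs_confined_strong u3A.
have [|u2 u2A] := pick (u4 |: (u3 |: (I4 :|: I3))).
  move: (c1 u4 (u3 |: (I4 :|: I3))) (c1 u3 (I4 :|: I3)) (cU I4 I3) i4 i3 geA.
  by clear; lia.
rewrite !inE !negb_or => /and4P[u24 u23 u2I4 u2I3].
have [K2 [I2 [k2 /small i2 /i2{}i2 s2]]] := common_nbrs_confined_strong u2A.
have [|u1 u1A] := pick (u4 |: (u3 |: (u2 |: (I4 :|: I3 :|: I2)))).
  move: (c1 u4 (u3 |: (u2 |: (I4 :|: I3 :|: I2)))) (c1 u3 (u2 |: (I4 :|: I3 :|: I2))).
  move: (c1 u2 (I4 :|: I3 :|: I2)) (cU (I4 :|: I3) I2) (cU I4 I3) i4 i3 i2 geA.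
  by clear; lia.
rewrite !inE !negb_or => /and4P[u14 u13 u12 /andP[/andP[u1I4 u1I3] u1I2]].
have le2 : #|N u2 :&: N u1| <= 3.
  by apply: leq_trans k2; apply/subset_leq_card/s2.
have le3 : #|N u3 :&: (N u2 :|: N u1)| <= 3.
  by apply: leq_trans k3; apply: subset_leq_card; rewrite setIUr subUset !s3.
have le4 : #|N u4 :&: (N u3 :|: (N u2 :|: N u1))| <= 3.
  by apply: leq_trans k4; apply: subset_leq_card; rewrite !setIUr !subUset !s4.
have : #|N u4 :|: (N u3 :|: (N u2 :|: N u1))| <= #|Y|.
  apply: subset_leq_card; rewrite !subUset.
  by apply/and4P; split; apply/subsetP=> y; rewrite inE; apply: nbrY.
rewrite cardY; move: le2 le3 le4 le_m.
move: (cardsUI (N u4) (N u3 :|: (N u2 :|: N u1))) (cardsUI (N u3) (N u2 :|: N u1)).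
move: (cardsUI (N u2) (N u1)) (deg u1A) (deg u2A) (deg u3A) (deg u4A).
by clear; lia.
Qed.
End CriticalBigraph.

(** * Triples of vertices and the induction *)

Section Bipartite.
Variables (G : sgraph) (X Y : {set G}).
Hypothesis bipXY : bipartition X Y.

Lemma edge_in_X u v : edge u v -> (u \in X) (+) (v \in X).
Proof.
case: bipXY => /setP XY /pred0P dXY iX iY euv.
have inY w : w \notin X -> w \in Y by have := XY w; rewrite !inE; case: (w \in X).
case: (boolP (u \in X)) => uX; case: (boolP (v \in X)) => vX //=.
  by have := iX u v uX vX; rewrite euv.
by have := iY u v (inY u uX) (inY v vX); rewrite euv.
Qed.

Lemma notin_X u : (u \notin X) = (u \in Y).
Proof.
case: bipXY => /setP XY dXY _ _; have := XY u; rewrite !inE.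
by case: (boolP (u \in X)) => //= uX _; rewrite (disjointFr dXY uX).
Qed.

Lemma super_nbrP (B : {set G}) y : B \subset X ->
  (y \in super_nbr Y B) = (1 < #|nbr y :&: B|).
Proof.
move=> sBX; rewrite inE; case: (boolP (y \in Y)) => //=.
rewrite -notin_X negbK => yX; apply/esym/negbTE; rewrite -leqNgt.
rewrite (_ : _ :&: _ = set0) ?cards0 //; apply/setP=> v; rewrite !inE.
apply/negP => /andP[/edge_in_X + /(subsetP sBX) vX]; by rewrite yX vX.
Qed.

Section Triple.
Variable B : {set G}.
Hypothesis sBX : B \subset X.
Hypothesis conn : kconnected_on 2 (B :|: super_nbr Y B).
Hypothesis leB : #|B| <= #|super_nbr Y B|.

Let S := B :|: super_nbr Y B.

Lemma super_notin_B y : y \in super_nbr Y B -> y \notin B.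
Proof.
rewrite inE -notin_X => /andP[yX _]; by apply: contra yX; apply: (subsetP sBX).
Qed.

(** The first edge of a path from [a] to [b] avoiding [D] leads to a super-neighbor. *)
Lemma super_nbr_avoiding (D : {set G}) a b : D \subset S -> #|D| < 2 ->
  a \in B -> b \in B -> a != b -> a \notin D -> b \notin D ->
  exists2 y, y \in super_nbr Y B :\: D & edge a y.
Proof.
move=> sDS D2 aB bB ab aD bD; have [_ /(_ D sDS D2)] := conn.
move=> /(_ a b); rewrite !inE aB bB aD bD => /(_ isT isT)/connectP[p].
case: p => [|y p] /=; first by move=> _ ba; rewrite ba eqxx in ab.
case/andP=> /and3P[_ + eay] _ _; rewrite in_setD in_setU => /andP[yD /orP[yB|yS]].
  have := edge_in_X eay; by rewrite (subsetP sBX a aB) (subsetP sBX y yB).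
by exists y => //; rewrite in_setD yD.
Qed.

(** Without a common neighbor, [W], which is [a] with its neighbors, would be closed under the edges
    left after deleting [d], and would separate [a] from [b]. *)
Lemma common_of_three a b d : B \subset [set a; b; d] -> a \in B -> b \in B ->
  d \in B -> a != b -> a != d -> b != d -> exists2 y, edge a y & edge b y.
Proof.
move=> sB aB bB dB ab ad bd; apply/exists_inP; apply: contraT => /exists_inPn no.
have [_ /(_ [set d])] := conn; rewrite sub1set !inE dB cards1 => /(_ isT isT a b).
rewrite !inE ad bd aB bB => /(_ isT isT)/connectP[p ep bE].
have [aX bX] := (subsetP sBX a aB, subsetP sBX b bB).
pose W := [pred w | (w == a) || edge a w].
have stepW u w : W u -> induced_edge (S :\ d) u w -> W w.
  move=> /orP[/eqP->|eau] /and3P[_ wS euw]; rewrite /= ?euw ?orbT //.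
  have wX : w \in X.
    by have := edge_in_X eau; rewrite aX; have := edge_in_X euw; case: (u \in X).
  have : w \in B.
    move: wS; rewrite in_setD in_setU => /andP[_ /orP[//|]].
    by rewrite inE -notin_X wX.
  move/(subsetP sB); rewrite !inE => /orP[/orP[->//|/eqP wb]|/eqP wd].
    by have := no u eau; rewrite edge_sym -wb euw.
  by move: wS; rewrite wd !inE eqxx.
have walk q u : W u -> path (induced_edge (S :\ d)) u q -> W (last u q).
  elim: q u => //= w q IHq u Wu /andP[euw]; apply: IHq; exact: stepW euw.
have : W b by rewrite bE; apply: walk ep; rewrite /= eqxx.
rewrite /= eq_sym (negPf ab) /= => /edge_in_X; by rewrite aX bX.
Qed.

(* Distinct common neighbors for the three pairs: a matching, given by [konig],
   between [B] and the vertices adjacent to the two other elements of [B]. *)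
Lemma triple_links a b d : B = [set a; b; d] -> a != b -> b != d -> d != a ->
  exists y1 y2 y3, [/\ y1 != y2, y2 != y3 & y3 != y1] /\
    [/\ edge a y1 && edge b y1, edge b y2 && edge d y2 & edge d y3 && edge a y3].
Proof.
move=> defB ab bd da.
have [ba [db ad]] : b != a /\ d != b /\ a != d by rewrite eq_sym ab eq_sym bd eq_sym.
have [aB bB dB] : [/\ a \in B, b \in B & d \in B] by rewrite defB !inE !eqxx !orbT.
have cB : #|B| = 3.
  by rewrite defB -setUA cardsU1 cards2 !inE negb_or ab bd ad.
pose E := [set p : G * G | (p.1 \in B) && [forall u in B, (u != p.1) ==> edge u p.2]].
have EP v y : v \in B -> (forall u, u \in B -> u != v -> edge u y) -> (v, y) \in E.
  by move=> vB H; rewrite inE vB /=; apply/forall_inP => u uB; apply/implyP/H.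
have superP y : y \in super_nbr Y B -> exists u v, [/\ u \in B, v \in B, u != v, edge u y & edge v y].
  rewrite super_nbrP // => /card_gt1P[u [v [+ + uv]]].
  rewrite !inE => /andP[yu uB] /andP[yv vB]; exists u, v.
  by split; rewrite // edge_sym.
have third u v : u \in B -> v \in B -> u != v -> exists w, [/\ w \in B, w != u, w != v &
    forall z, z \in B -> z != w -> z = u \/ z = v].
  rewrite defB !inE => /orP[/orP[]|] /eqP-> /orP[/orP[]|] /eqP->; rewrite ?eqxx // => _;
    [exists d|exists b|exists d|exists a|exists b|exists a];
    split; rewrite ?inE ?eqxx ?orbT // => z; rewrite !inE;
    by case/orP=> [/orP[]|] /eqP->; rewrite ?eqxx; auto.
have thirdE u v y : u \in B -> v \in B -> u != v -> edge u y -> edge v y ->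
    exists w, [/\ w \in B, w != u, w != v & (w, y) \in E].
  move=> uB vB uv euy evy; have [w [wB wu wv wP]] := third u v uB vB uv.
  by exists w; split=> //; apply: EP => // z zB /(wP z zB)[]->.
have coverE (L R : {set G}) : is_cover E L R -> 3 <= #|L| + #|R|.
  move=> /forall_inP cLR.
  have inR w y : (w, y) \in E -> w \notin L -> y \in R.
    by move=> /cLR /= /orP[->|].
  have R1 u v w : B \subset [set u; v; w] -> u \in B -> v \in B -> w \in B ->
      u != v -> u != w -> v != w -> w \notin L -> 0 < #|R|.
    move=> sB uB vB wB uv uw vw wL; have [y euy evy] := common_of_three sB uB vB wB uv uw vw.
    apply/card_gt0P; exists y; apply: (inR w) => //; apply: EP => // z.
    by move/(subsetP sB); rewrite !inE => /orP[/orP[]|] /eqP-> //; rewrite eqxx.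
  (* Two super-neighbors of [u] exist, the second by deleting the first; each is paired in [E] with
     a vertex of [B] other than [u], so [R] must contain it. *)
  have R2 u u' : u \in B -> u' \in B -> u != u' ->
      (forall v, v \in B -> v != u -> v \notin L) -> 1 < #|R|.
    move=> uB u'B uu' nL.
    have yR y : y \in super_nbr Y B -> edge u y -> y \in R.
      move=> /superP[v1 [v2 [v1B v2B v12 e1 e2]]] euy.
      have [v [vB uv evy]] : exists v, [/\ v \in B, u != v & edge v y].
        by have [uv1|] := eqVneq u v1; [exists v2; rewrite uv1 | exists v1].
      have [w [wB wu _ wE]] := thirdE u v y uB vB uv euy evy.
      exact: inR wE (nL w wB wu).
    have [y1 + e1] : exists2 y, y \in super_nbr Y B :\: set0 & edge u y.
      by apply: (super_nbr_avoiding _ _ uB u'B uu'); rewrite ?sub0set ?cards0 ?in_set0.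
    rewrite setD0 => y1S; have y1B := super_notin_B y1S.
    have [y2 + e2] : exists2 y, y \in super_nbr Y B :\: [set y1] & edge u y.
      apply: (super_nbr_avoiding _ _ uB u'B uu'); rewrite ?sub1set ?cards1 ?in_set1 //.
      - by rewrite in_setU y1S orbT.
      - by apply: contraNneq y1B => <-.
      - by apply: contraNneq y1B => <-.
    move=> /setD1P[y21 y2S].
    by apply/card_gt1P; exists y1, y2; rewrite !yR // eq_sym.
  have R3 : (forall v, v \in B -> v \notin L) -> 2 < #|R|.
    move=> nL; rewrite -cB; apply: leq_trans leB _; apply/subset_leq_card/subsetP.
    move=> y /superP[v1 [v2 [v1B v2B v12 e1 e2]]].
    have [w [wB _ _ wE]] := thirdE v1 v2 y v1B v2B v12 e1 e2.
    exact: inR wE (nL w wB).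
  have L3 : (a \in L) + (b \in L) + (d \in L) <= #|L|.
    rewrite (cardsD1 a L) (cardsD1 b (L :\ a)) (cardsD1 d (L :\ a :\ b)) !inE.
    by rewrite ba da db /= -!addnA !leq_add2l leq_addr.
  have BP v : v \in B -> [\/ v = a, v = b | v = d].
    by rewrite defB !inE => /orP[/orP[]|] /eqP->; [constructor 1|constructor 2|constructor 3].
  have sB1 : B \subset [set a; b; d] by rewrite defB.
  have sB2 : B \subset [set a; d; b] by rewrite defB setUAC.
  have sB3 : B \subset [set b; d; a] by rewrite defB -setUA setUC.
  case: (boolP (a \in L)) L3 => aL; case: (boolP (b \in L)) => bL;
    case: (boolP (d \in L)) => dL /= L3.
  - by apply: leq_trans L3 (leq_addr _ _).
  - by have := R1 a b d sB1 aB bB dB ab ad bd dL; move: L3; clear; lia.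
  - by have := R1 a d b sB2 aB dB bB ad ab db bL; move: L3; clear; lia.
  - have : 1 < #|R| by apply: (R2 a b) => // v /BP[]-> //; rewrite eqxx.
    by move: L3; clear; lia.
  - by have := R1 b d a sB3 bB dB aB bd ba da aL; move: L3; clear; lia.
  - have : 1 < #|R| by apply: (R2 b a) => // v /BP[]-> //; rewrite eqxx.
    by move: L3; clear; lia.
  - have : 1 < #|R| by apply: (R2 d a) => // v /BP[]-> //; rewrite eqxx.
    by move: L3; clear; lia.
  - by apply: leq_trans (leq_addl _ _); apply: R3 => v /BP[]->.
have [M [sME M3 inj1 inj2]] := konig coverE.
have MB v : v \in B -> exists2 y, (v, y) \in M & forall u, u \in B -> u != v -> edge u y.
  have sfst : [set p.1 | p in M] \subset B.
    by apply/subsetP=> _ /imsetP[p /(subsetP sME) + ->]; rewrite inE => /andP[].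
  have /eqP EB : [set p.1 | p in M] == B.
    by rewrite eqEcard sfst card_in_imset // cB.
  rewrite -{1}EB; case/imsetP=> -[w y] pM /= ->; exists y => // u uB uw.
  have := subsetP sME _ pM; rewrite inE /= => /andP[_ /forall_inP/(_ u uB)].
  by rewrite uw.
have [[[ya aM ea] [yb bM eb]] [yd dM ed]] := (MB a aB, MB b bB, MB d dB).
have neq u v y z : u != v -> (u, y) \in M -> (v, z) \in M -> y != z.
  by move=> uv uM vM; apply: contraNneq uv => yz; have [] := inj2 _ _ uM vM yz; move=> ->.
(* Each vertex is named after the element of [B] that its matching edge leaves out. *)
exists yd, ya, yb; split; split.
- exact: neq da dM aM.
- exact: neq ab aM bM.
- exact: neq bd bM dM.
- by rewrite !ed.
- by rewrite !ea.
- by rewrite !eb.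
Qed.
End Triple.

Lemma nbr_card_bip (A B : {set G}) y : A \subset X -> B \subset A -> y \in Y ->
  [set v | edge y v && ((y \in A) (+) (v \in A))] :&: B = nbr y :&: B.
Proof.
move=> sAX sBA; rewrite -notin_X => yX; apply/setP=> v; rewrite !inE.
case: (boolP (v \in B)) => [vB|]; rewrite ?andbF // !andbT.
have -> : y \in A = false by apply: contraNF yX; apply: (subsetP sAX).
by rewrite (subsetP sBA v vB) andbT.
Qed.
End Bipartite.

Theorem theorem1p8 (n m delta : nat) (G : sgraph) (X Y : {set G})
    (hn : 2 <= n) (hm : 0 < m) (hdelta : 0 < delta) (hdm : delta <= m)
    (hdn : n <= delta) (hdm4 : m + 10 <= 4 * delta)
    (hG : in_class n m delta X Y)
    (hA : forall A : {set G}, A \subset X -> 3 <= #|A| ->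
       #|A| <= #|super_nbr Y A| /\ kconnected_on 2 (A :|: super_nbr Y A)) :
  super_cyclic X.
Proof.
have [bip cX cY degX] := hG.
move=> A sAX A3; have [k] := ubnP #|A|; elim: k A sAX A3 => // k IHk A sAX A3.
rewrite ltnS => leAk.
have links a b d : a \in X -> b \in X -> d \in X -> a != b -> b != d -> d != a ->
    exists y1 y2 y3, [/\ y1 != y2, y2 != y3 & y3 != y1] /\
      [/\ edge a y1 && edge b y1, edge b y2 && edge d y2 & edge d y3 && edge a y3].
  move=> aX bX dX ab bd da; have sB : [set a; b; d] \subset X.
    by rewrite !subUset !sub1set aX bX dX.
  have cB : 2 < #|[set a; b; d]|.
    by apply/card_gt2P; exists a, b, d; rewrite !inE !eqxx !orbT.
  have [le_super conn] := hA _ sB cB.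
  exact: (triple_links bip sB conn le_super erefl ab bd da).
have inY a y : a \in X -> edge a y -> y \notin X.
  by move=> aX /(edge_in_X bip); rewrite aX; case: (y \in X).
have [A4|A4] := leqP 4 #|A|; last first.
  have /card_gt2P[a [b [d [[aA bA dA] [ab bd da]]]]] := A3.
  have [aX bX dX] := And3 (subsetP sAX a aA) (subsetP sAX b bA) (subsetP sAX d dA).
  have [y1 [y2 [y3 [[y12 y23 y31] [/andP[a1 b1] /andP[b2 d2] /andP[d3 a3]]]]]] :=
    links a b d aX bX dX ab bd da.
  have defA : [set a; b; d] = A.
    apply/eqP; rewrite eqEcard !subUset !sub1set aA bA dA /=.
    by rewrite -setUA cardsU1 cards2 !inE negb_or ab bd eq_sym da.
  have [y1X y2X y3X] := And3 (inY a y1 aX a1) (inY b y2 bX b2) (inY d y3 dX d3).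
  exists [:: a; y1; b; y2; d; y3]; split.
    split=> //; apply/andP; split.
      by rewrite /= a1 b2 d3 edge_sym b1 edge_sym d2 edge_sym a3.
    have Ux : uniq [:: a; b; d] by rewrite /= !inE negb_or ab bd eq_sym da.
    have Uy : uniq [:: y1; y2; y3] by rewrite /= !inE negb_or y12 y23 eq_sym y31.
    rewrite -(perm_uniq (s1 := [:: a; b; d] ++ [:: y1; y2; y3])).
      rewrite cat_uniq Ux Uy andbT andTb; apply/hasPn => y.
      rewrite !inE => /orP[/eqP->|/orP[/eqP->|/eqP->]]; apply/negP;
        move=> /orP[/eqP E|/orP[/eqP E|/eqP E]]; move: y1X y2X y3X; by rewrite E ?aX ?bX ?dX.
    apply/permP => P /=; clear.
    move: (P a : nat) (P b : nat) (P d : nat) (P y1 : nat) (P y2 : nat) (P y3 : nat).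
    by clear; lia.
  apply/setP=> v; rewrite -defA !inE; case: (boolP (v \in X)) => vX.
    rewrite andbT; have yF y : y \notin X -> (v == y) = false.
      by move=> yX; apply: contraNF yX => /eqP<-.
    by rewrite (yF _ y1X) (yF _ y2X) (yF _ y3X) /= orbF orbA.
  rewrite andbF; have xF u : u \in X -> (v == u) = false.
    by move=> uX; apply: contraNF vX => /eqP->.
  by rewrite !xF.
pose good (c : seq G) := [&& cycle (@edge G) c, 2 < size c & [set v in c] :&: X == A].
have [/uniq_exP[c Uc /and3P[ec c2 /eqP cA]]|no_cycle] :=
    boolP [exists j : 'I_#|G|.+1, [exists t : j.-tuple G, uniq t && good t]].
  by exists c; split=> //; split=> //; rewrite /ucycle ec.
(* Only edges with exactly one end in [A] are kept, which loses no neighbor of a vertex of [A]. *)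
exfalso; pose e : rel G := fun u v => edge u v && ((u \in A) (+) (v \in A)).
have e_edge : subrel e (@edge G) by move=> u v /andP[].
have eA a y : a \in A -> e a y = edge a y.
  move=> aA; rewrite /e aA; case: (boolP (edge a y)) => //= eay.
  by apply: contra (inY a y (subsetP sAX a aA) eay) => /(subsetP sAX).
have NA a : a \in A -> [set v | e a v] = nbr a.
  by move=> aA; apply/setP=> v; rewrite !inE eA.
apply: (@no_critical_bigraph G e A _ _ _ Y m delta) => //.
- by move=> u v; rewrite /e edge_sym addbC.
- by move=> u v /andP[].
- move=> c /andP[ec Uc] sAc; case/negP: no_cycle; apply/uniq_exP; exists c => //.
  apply/and3P; split; first exact: sub_cycle ec.
    apply: leq_trans A3 _; apply: leq_trans (card_size c).
    by apply/subset_leq_card/subsetP.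
  rewrite eqEsubset; apply/andP; split; apply/subsetP => v; rewrite !inE; last first.
    by move=> vA; rewrite sAc //= (subsetP sAX).
  (* The successor of [v] is outside [X], hence outside [A]; by the definition of [e], [v] is then
     in [A]. *)
  case/andP=> vc vX; have := next_cycle ec vc; rewrite /e; case/andP=> /(edge_in_X bip).
  rewrite vX /= => nX; case: (boolP (v \in A)) => //= vA nA.
  by rewrite (subsetP sAX _ nA) in nX.
- move=> a y aA; rewrite eA // => /(inY a y (subsetP sAX a aA)).
  by rewrite (notin_X bip).
- by move=> a aA; rewrite NA //; apply/degX/(subsetP sAX).
- by apply: leq_trans hdn; rewrite -cX subset_leq_card.
- move=> B sBA B3; have [le_super _] := hA B (subset_trans sBA sAX) B3.
  apply: leq_trans le_super _; apply/subset_leq_card/subsetP=> y.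
  rewrite !inE => /andP[yY y2]; rewrite yY /=.
  by rewrite (nbr_card_bip bip sAX sBA yY).
- move=> x u xA uA xu.
  have [w wA] : exists2 w, w \in A & w \notin [set x; u].
    apply/subsetPn/negP => /subset_leq_card; rewrite cards2 xu => le2.
    by have := leq_trans A3 le2.
  rewrite !inE negb_or => /andP[wx wu].
  have uw : u != w by rewrite eq_sym.
  have [y1 [_ [_ [_ [/andP[xy uy] _ _]]]]] := links x u w (subsetP sAX _ xA)
    (subsetP sAX _ uA) (subsetP sAX _ wA) xu uw wx.
  by exists y1; rewrite !eA ?xy.
- move=> x u v xA uA vA xu xv uv; have vx : v != x by rewrite eq_sym.
  have [y1 [_ [y3 [[_ _ y31] [/andP[xy uy] _ /andP[vy xy3]]]]]] :=
    links x u v (subsetP sAX _ xA) (subsetP sAX _ uA) (subsetP sAX _ vA) xu uv vx.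
  by apply/card_gt1P; exists y1, y3; rewrite !inE !eA // xy uy vy xy3 orbT eq_sym.
- move=> x xA; have cAx : #|A :\ x| = #|A|.-1 by rewrite (cardsD1 x A) xA.
  have [|||c [[_ /andP[ec Uc]] cA]] := IHk (A :\ x).
  + exact: subset_trans (subsetDl _ _) sAX.
  + by rewrite cAx; case: #|A| A4.
  + by rewrite cAx; case: #|A| A3 leAk => //= j _; rewrite ltnS.
  (* The cycle through [A :\ x] meets [X] only in [A], so all its edges belong to [e]. *)
  have cP v : v \in c -> (v \in A) = (v \in X).
    move=> vc; apply/idP/idP => [/(subsetP sAX)//|vX].
    by have : v \in A :\ x; [rewrite -cA !inE vc | rewrite !inE => /andP[]].
  exists c; split.
    apply/andP; split=> //; apply: (sub_in_cycle (P := mem c)) ec; last by apply/allP.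
    by move=> u v uc vc euv; rewrite /e euv !cP // (edge_in_X bip).
  move=> a aA; have /setP/(_ a) := cA; rewrite !inE (subsetP sAX) // aA !andbT.
  by [].
Qed.
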